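(* Let $f=\{f_k:A^{\otimes k}\to C^*\}_{k\ge1}$ be a rational pairing of an $A_\infty$-coalgebra $C$ and an $A_\infty$-algebra $A$. Then the functor $\iota(C,A):\mathbf M^C\to{}_A\mathbf M$ embeds $\mathbf M^C$ as a full subcategory of ${}_A\mathbf M$.
   Context: $K$ is a field; Koszul sign conventions apply. $Vect^{\mathbb Z}$ is the category of graded vector spaces, closed symmetric monoidal with internal hom $[W',W]_p=\prod_kVect(W'_k,W_{k+p})$. $A_\infty$-algebra: graded space $A$ with maps $m_k:A^{\otimes k}\to A$ of degree $2-k$ ($k\ge1$), $\sum_{p+q+r=n}(-1)^{p+qr}m_{p+1+r}(1^{\otimes p}\otimes m_q\otimes1^{\otimes r})=0$ for $n\ge1$ ($p,r\ge0,q\ge1$). Morphism $f:A\to B$: maps $f_k:A^{\otimes k}\to B$ of degree $1-k$ with $\sum(-1)^{p+qr}f_{p+1+r}(1^{\otimes p}\otimes m_q\otimes1^{\otimes r})=\sum(-1)^sm_t(f_{i_1}\otimes\dots\otimes f_{i_t})$ for each $n\ge1$, the first sum over $p+q+r=n$, the second over $1\le t\le n$, $i_1+\dots+i_t=n$, $s=(t-1)(i_1-1)+(t-2)(i_2-1)+\dots+(i_{t-1}-1)$. Left $A_\infty$-module: graded space $M$ with $m^M_k:A^{\otimes k-1}\otimes M\to M$ of degree $2-k$, $\sum_{p+q+r=n,\,q,r\ge1}(-1)^{p+qr}m^M_{p+1+r}(1^{\otimes p}\otimes m_q\otimes1^{\otimes r-1}\otimes1_M)+\sum_{a+b=n,\,b\ge1}(-1)^am^M_{a+1}(1^{\otimes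 a}\otimes m_b^M)=0$ for $n\ge1$. Morphisms in ${}_A\mathbf M$ are degree-preserving maps compatible with all structure maps. $A_\infty$-coalgebra: graded space $C$ with $w_k:C\to C^{\otimes k}$ of degree $2-k$ ($k\ge1$), $\sum_{p+q+r=n}(-1)^{pq+r}(1^{\otimes p}\otimes w_q\otimes1^{\otimes r})w_{p+1+r}=0$ for $n\ge1$ ($p,r\geq 0$, $q\geq 1$), and such that $\prod_kw_k:C\to\prod_kC^{\otimes k}$ factors through $\bigoplus_kC^{\otimes k}$. Right $A_\infty$-comodule: graded space $P$ with $w^P_k:P\to P\otimes C^{\otimes k-1}$ of degree $2-k$ satisfying $\sum_{p+q+r=n,\,p,q\ge1}(-1)^{pq+r}(1_P\otimes1^{\otimes p-1}\otimes w_q\otimes1^{\otimes r})w^P_{p+1+r}+\sum_{b+c=n,\,b\ge1}(-1)^c(w^P_b\otimes1^{\otimes c})w^P_{c+1}=0$ for $n\ge1$. Morphisms in $\mathbf M^C$ are degree-preserving maps compatible with all structure maps. Graded dual: $C^*_n=Vect(C_{-n},K)$, an $A_\infty$-algebra with $m_k(\phi_1\otimes\dots\otimes\phi_k)=(-1)^{k(|\phi_1|+\dots+|\phi_k|+1)}\mu\circ(\phi_1\otimes\dots\otimes\phi_k)\circ w_k$, $\mu$ the multiplication of $K$. A pairing between $C$ and $A$ is a morphism of $A_\infty$-algebras $f=\{f_k:A^{\otimes k}\to C^*\}_{k\ge1}$. The functor $\iota(C,A)$ is the composite of $\mathbf M^C\to{}_{C^*}\mathbf M$, regarding $M$ as a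 left $C^*$-module via $(C^* )^{\otimes k-1}\otimes M\xrightarrow{1\otimes w^M_k}(C^* )^{\otimes k-1}\otimes M\otimes C^{\otimes k-1}\to M$ (evaluating $(C^* )^{\otimes k-1}$ on $C^{\otimes k-1}$), and restriction of scalars along $f$: $m^{A,M}_{k+1}=\sum(-1)^sm^{C^*,M}_{l+1}(f_{i_1}\otimes\dots\otimes f_{i_l}\otimes M)$, $k\ge0$, over decompositions $k=i_1+\dots+i_l$ with $s=(l-1)(i_1-1)+(l-2)(i_2-1)+\dots+(i_{l-1}-1)$. Rational pairing: let $\tilde f:\bigoplus_{k\ge0}A^{\otimes k}\to\bigoplus_{l\ge0}(C^* )^{\otimes l}$ be the map acting on $A^{\otimes k}$ by $\sum(-1)^s(f_{i_1}\otimes\dots\otimes f_{i_l})$ over decompositions $k=i_1+\dots+i_l$, with $s=(l-1)(i_1-1)+(l-2)(i_2-1)+\dots+(i_{l-1}-1)$. For $V\in Vect^{\mathbb Z}$ let $\alpha(C,A,V)$ be the composite $\prod_{l\ge0}V\otimes C^{\otimes l}\to\prod_{l\ge0}[(C^* )^{\otimes l},V]\xrightarrow{[\tilde f,V]}\prod_{k\ge0}[A^{\otimes k},V]$, the first map being the canonical evaluation map. The pairing is rational if $\alpha(C,A,V)$ is a monomorphism for every $V\in Vect^{\mathbb Z}$.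
   Formalization: The printed sign s in restriction of scalars does not give an A∞-module in general; the formal functor adds (i_1-1)+...+(i_l-1) to s (M counted as a last block). For the printed s only the full embedding into graded spaces with structure maps is asserted. *)

(* Defs.v *)
(* MathComp, with the classical layer of MathComp-Analysis (boolp, fsbigop,
   functions) and the free modules {malg K[X]} of multinomials.

   A graded vector space is presented internally: the vector space of all
   finite sums of homogeneous elements, with the projections onto the
   homogeneous components.  A family of maps m_k : A^{(x)k} -> B (k >= 1) is a
   single function on sequences, linear in each entry, whose restriction to the
   sequences of length k is m_k. *)
From HB Require Import structures.
From mathcomp Require Import all_boot all_order all_algebra.
From mathcomp Require Import generic_quotient ring_quotient.
From mathcomp Require Import finmap.
From mathcomp Require Import mathcomp_extra boolp classical_sets functions.
From mathcomp Require Import cardinality fsbigop.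
From mathcomp Require Import monalg.

Set Implicit Arguments.
Unset Strict Implicit.
Unset Printing Implicit Defensive.

Import GRing.Theory.
Local Open Scope ring_scope.
Local Open Scope quotient_scope.

Record gspace (K : fieldType) := GSpace {
  gcar :> lmodType K;
  gproj : int -> gcar -> gcar;
  gproj_linear : forall n, linear (gproj n);
  gprojK : forall m n v,
    gproj m (gproj n v) = if m == n then gproj n v else 0;
  gproj_sum : forall v, exists2 s : seq int,
    uniq s & v = \sum_(n <- s) gproj n v
}.

Section GradedSpaces.
Variable K : fieldType.
Implicit Types V W : gspace K.

Definition homog V (n : int) (v : V) : Prop := gproj n v = v.

Fixpoint hseq V (ds : seq int) (s : seq V) : Prop :=
  match ds, s with
  | [::], [::] => True
  | d :: ds', v :: s' => homog d v /\ hseq ds' s'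
  | _, _ => False
  end.

Definition sumz (ds : seq int) : int := \sum_(d <- ds) d.

Definition degree_preserving V W (g : V -> W) : Prop :=
  forall n v, g (gproj n v) = gproj n (g v).

(* The extension to all of V of a formula F n v given for v homogeneous of
   degree n; the sum has finitely many nonzero terms as soon as F n 0 = 0. *)
Definition hsum V (U : lmodType K) (F : int -> V -> U) (v : V) : U :=
  \sum_(n \in [set: int]) F n (gproj n v).

(* The Koszul sign (-1)^{d|v|} for moving an operator of degree d past v. *)
Definition ksgn V (d : int) (v : V) : V :=
  hsum (fun n vn => ((-1) ^ (d * n) : K) *: vn) v.

Lemma gproj0 V n : gproj n (0 : V) = 0.
Proof.
have := gproj_linear n (-1) (0 : V) 0.
by rewrite scaler0 addr0 scaleN1r addNr.
Qed.

Lemma gproj_sum_notin V (v : V) (s : seq int) m :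
  v = \sum_(n <- s) gproj n v -> m \notin s -> gproj m v = 0.
Proof.
move=> vE ms; rewrite vE.
have gD x y : gproj m (x + y) = gproj m x + gproj m y :> V.
  by have := gproj_linear m 1 x y; rewrite !scale1r.
rewrite (big_morph (gproj m) gD (gproj0 V m)) big_seq big1 // => n ns.
by rewrite gprojK ifF //; apply: contraNF ms => /eqP->.
Qed.

Lemma gproj_supp V (v : V) :
  exists2 s : seq int, uniq s & forall n, n \notin s -> gproj n v = 0.
Proof.
have [s us vE] := gproj_sum v.
by exists s => // n; exact: gproj_sum_notin.
Qed.

Lemma hsumE V (U : lmodType K) (F : int -> V -> U) v (s : seq int) :
  (forall n, F n 0 = 0) -> uniq s -> (forall n, n \notin s -> gproj n v = 0) ->
  hsum F v = \sum_(n <- s) F n (gproj n v).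
Proof.
move=> F0 us vs; rewrite /hsum [RHS]fsbig_seq //; symmetry; apply: fsbig_widen => // n.
by move=> [_ /negP ns] /=; rewrite vs.
Qed.

Lemma linearP0 (U W : lmodType K) (F : U -> W) : linear F -> F 0 = 0.
Proof.
by move=> lF; have := lF (-1) 0 0; rewrite scaler0 addr0 scaleN1r addNr.
Qed.

Lemma hsum_linear V (U : lmodType K) (F : int -> V -> U) :
  (forall n, linear (F n)) -> linear (hsum F).
Proof.
move=> lF a u v.
have F0 n : F n 0 = 0 by exact: linearP0.
have [s1 us1 u1] := gproj_supp u; have [s2 us2 v2] := gproj_supp v.
pose s := undup (s1 ++ s2).
have us : uniq s by exact: undup_uniq.
have us' n : n \notin s -> gproj n u = 0.
  by rewrite mem_undup mem_cat negb_or => /andP[/u1].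
have vs' n : n \notin s -> gproj n v = 0.
  by rewrite mem_undup mem_cat negb_or => /andP[_ /v2].
rewrite !(hsumE (s := s)) //; last first.
  by move=> n ns; rewrite gproj_linear us' // vs' // scaler0 addr0.
rewrite scaler_sumr -big_split /=; apply: eq_bigr => n _.
by rewrite gproj_linear lF.
Qed.

Lemma hsum_homog V (U : lmodType K) (F : int -> V -> U) d v :
  (forall n, F n 0 = 0) -> homog d v -> hsum F v = F d v.
Proof.
move=> F0 hv; rewrite (hsumE (s := [:: d])) //.
  by rewrite big_seq1 hv.
by move=> n; rewrite inE => nd; rewrite -hv gprojK (negbTE nd).
Qed.

End GradedSpaces.

Lemma unit_proj_linear (K : fieldType) (n : int) :
  linear (fun a : K^o => if n == 0 then a else 0 : K^o).
Proof. by move=> a u v; case: (n == 0) => //; rewrite scaler0 addr0. Qed.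

Lemma unit_projK (K : fieldType) (m n : int) (a : K^o) :
  (if m == 0 then (if n == 0 then a else 0) else 0) =
  (if m == n then (if n == 0 then a else 0) else 0) :> K^o.
Proof. by have [->|n0] := eqVneq n 0; rewrite ?if_same. Qed.

Lemma unit_proj_sum (K : fieldType) (a : K^o) : exists2 s : seq int,
  uniq s & a = \sum_(n <- s) (if n == 0 then a else 0).
Proof. by exists [:: 0]; rewrite // big_seq1 eqxx. Qed.

Definition gunit (K : fieldType) : gspace K :=
  GSpace (@unit_proj_linear K) (@unit_projK K) (@unit_proj_sum K).

Section PresentedModules.
Variables (K : fieldType) (X : choiceType) (R : set {malg K[X]}).

Inductive rspan : {malg K[X]} -> Prop :=
| rspan0 : rspan 0
| rspanD a r x of R r & rspan x : rspan (a *: r + x).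

Definition rspanb : {pred {malg K[X]}} := fun x => `[< rspan x >].

Lemma rspanb_submod : submod_closed rspanb.
Proof.
split=> [|a x y /asboolP rx /asboolP ry]; apply/asboolP; first exact: rspan0.
elim: rx => [|b r x' Rr _ ih]; first by rewrite scaler0 add0r.
by rewrite scalerDr scalerA -addrA; exact: rspanD.
Qed.

HB.instance Definition _ :=
  GRing.isSubmodClosed.Build K {malg K[X]} rspanb rspanb_submod.

Definition presmod := {ideal_quot rspanb}.
HB.instance Definition _ := GRing.Zmodule.on presmod.
HB.instance Definition _ := EqQuotient.on presmod.

Definition presmod_scale (a : K) (x : presmod) : presmod :=
  \pi_presmod (a *: repr x).

Lemma presmod_eq (x y : {malg K[X]}) :
  rspan (x - y) <-> \pi_presmod x = \pi_presmod y.
Proof.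
split=> [h|/eqP]; first by apply/eqP; rewrite -Quotient.idealrBE; apply/asboolP.
by rewrite -Quotient.idealrBE => /asboolP.
Qed.

Lemma pi_presmodZ a (x : {malg K[X]}) :
  \pi_presmod (a *: x) = presmod_scale a (\pi_presmod x).
Proof.
apply/esym/presmod_eq; rewrite -scalerBr.
have /presmod_eq h : \pi_presmod (repr (\pi_presmod x)) = \pi_presmod x.
  by rewrite reprK.
have hI : repr (\pi_presmod x) - x \in rspanb by apply/asboolP.
by have /asboolP := rpredZ a hI.
Qed.

Lemma pi_presmodD (x y : {malg K[X]}) :
  \pi_presmod (x + y) = \pi_presmod x + \pi_presmod y.
Proof. exact: Quotient.pi_add. Qed.

Lemma pi_presmod_surj (x : presmod) : exists y, x = \pi_presmod y.
Proof. by exists (repr x); rewrite reprK. Qed.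

Lemma presmod_scaleA a b (x : presmod) :
  presmod_scale a (presmod_scale b x) = presmod_scale (a * b) x.
Proof. by have [y ->] := pi_presmod_surj x; rewrite -!pi_presmodZ scalerA. Qed.

Lemma presmod_scale1 : left_id 1 presmod_scale.
Proof.
by move=> x; have [y ->] := pi_presmod_surj x; rewrite -pi_presmodZ scale1r.
Qed.

Lemma presmod_scaleDr : right_distributive presmod_scale +%R.
Proof.
move=> a x y; have [x' ->] := pi_presmod_surj x.
have [y' ->] := pi_presmod_surj y.
by rewrite -pi_presmodD -!pi_presmodZ scalerDr pi_presmodD.
Qed.

Lemma presmod_scaleDl (x : presmod) :
  {morph presmod_scale^~ x : a b / a + b}.
Proof.
have [y ->] := pi_presmod_surj x.
by move=> a b; rewrite -!pi_presmodZ scalerDl pi_presmodD.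
Qed.

HB.instance Definition _ := GRing.Zmodule_isLmodule.Build K presmod
  presmod_scaleA presmod_scale1 presmod_scaleDr presmod_scaleDl.

End PresentedModules.

Section Lift.
Variables (K : fieldType) (X : choiceType) (R : set {malg K[X]}).
Variable U : lmodType K.
Implicit Type F : X -> U.

Definition mlin F (x : {malg K[X]}) : U := \sum_(k <- msupp x) x@_k *: F k.

Definition plift F (t : presmod R) : U := mlin F (repr t).

Lemma mlinEw F x (S : {fset X}) : (msupp x `<=` S)%fset ->
  mlin F x = \sum_(k <- S) x@_k *: F k.
Proof.
move=> xS; rewrite /mlin; apply: big_fset_incl => // k _ kx.
by rewrite mcoeff_outdom // scale0r.
Qed.

Lemma mlin_linear F : linear (mlin F).
Proof.
move=> a x y; pose S := (msupp x `|` msupp y `|` msupp (a *: x + y))%fset.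
rewrite !(mlinEw F (S := S)); first last.
- exact: fsubsetUr.
- by apply: fsubset_trans (fsubsetUl _ _); exact: fsubsetUl.
- by apply: fsubset_trans (fsubsetUl _ _); exact: fsubsetUr.
rewrite scaler_sumr -big_split /=; apply: eq_bigr => k _.
by rewrite mcoeffD mcoeffZ scalerDl scalerA.
Qed.

Lemma mlinU F k : mlin F << k >> = F k.
Proof.
rewrite (mlinEw F (S := [fset k]%fset)) ?msuppU_le //.
by rewrite big_seq_fset1 mcoeffUU scale1r.
Qed.

Lemma plift_pi F x : (forall r, R r -> mlin F r = 0) ->
  plift F (\pi_(presmod R) x) = mlin F x.
Proof.
move=> FR; apply/eqP; rewrite /plift -subr_eq0 -scaleN1r addrC; apply/eqP.
rewrite -(mlin_linear F (-1) x); set z := _ + _.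
have: rspan R z.
  by rewrite /z scaleN1r addrC; apply/presmod_eq; rewrite reprK.
elim=> [|a r y /FR r0 _ y0]; first exact: (linearP0 (@mlin_linear F)).
by rewrite mlin_linear r0 y0 scaler0 addr0.
Qed.

Lemma plift_linear F : (forall r, R r -> mlin F r = 0) -> linear (plift F).
Proof.
move=> FR a x y; have [x' ->] := pi_presmod_surj x.
have [y' ->] := pi_presmod_surj y.
rewrite -[a *: _]pi_presmodZ -pi_presmodD !plift_pi //.
exact: mlin_linear.
Qed.

End Lift.

Section Tensors.
Variable K : fieldType.

(* V (x) T(C), where T(C) is the tensor algebra: the module generated by the
   words v (x) c_1 (x) ... (x) c_l, subject to linearity in each entry.  The
   words of length l span the summand V (x) C^{(x)l}.  The power C^{(x)l} itself
   is taken to be K (x) C^{(x)l}. *)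
Section TensorSpace.
Variables V C : lmodType K.

Variant tens_rel : {malg K[(V * seq C)%type]} -> Prop :=
| tens_rel_head a v v' cs :
    tens_rel (<< (a *: v + v', cs) >> - a *: << (v, cs) >> - << (v', cs) >>)
| tens_rel_word a v s1 c c' s2 :
    tens_rel (<< (v, s1 ++ (a *: c + c') :: s2) >>
              - a *: << (v, s1 ++ c :: s2) >> - << (v, s1 ++ c' :: s2) >>).

Definition tens : lmodType K := presmod tens_rel.

Definition pure (v : V) (cs : seq C) : tens :=
  \pi_(presmod tens_rel) << (v, cs) >>.

(* The linear map on V (x) T(C) given on words by F; it is meaningful when F is
   linear in v and in each entry of cs (tlift_pure). *)
Definition tlift (U : lmodType K) (F : V -> seq C -> U) : tens -> U :=
  plift (fun k : V * seq C => F k.1 k.2).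

Definition multilinear (U : lmodType K) (F : V -> seq C -> U) : Prop :=
  (forall cs, linear (F^~ cs)) /\
  (forall v s1 s2, linear (fun c => F v (s1 ++ c :: s2))).

Lemma tlift_rel (U : lmodType K) (F : V -> seq C -> U) : multilinear F ->
  forall r, tens_rel r -> mlin (fun k : V * seq C => F k.1 k.2) r = 0.
Proof.
move=> [F1 F2] r.
have mB (x y : {malg K[(V * seq C)%type]}) a :
    mlin (fun k : V * seq C => F k.1 k.2) (x - a *: y) =
    mlin (fun k => F k.1 k.2) x - a *: mlin (fun k => F k.1 k.2) y.
  have := mlin_linear (fun k : V * seq C => F k.1 k.2) (- a) y x.
  by rewrite !scaleNr [_ + x]addrC => ->; rewrite addrC.
case=> [a v v' cs|a v s1 c c' s2]; rewrite -[X in _ - X]scale1r !mB !mlinU scale1r /=.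
  by rewrite F1 addrAC addrK subrr.
by rewrite F2 addrAC addrK subrr.
Qed.

Lemma tlift_pure (U : lmodType K) (F : V -> seq C -> U) v cs :
  multilinear F -> tlift F (pure v cs) = F v cs.
Proof. by move=> mF; rewrite /tlift plift_pi ?mlinU //; exact: tlift_rel. Qed.

Lemma tlift_linear (U : lmodType K) (F : V -> seq C -> U) :
  multilinear F -> linear (tlift F).
Proof. by move=> mF; apply: plift_linear; exact: tlift_rel. Qed.

Lemma pure_multilinear : multilinear pure.
Proof.
have piE a (x y z : {malg K[(V * seq C)%type]}) : tens_rel (x - a *: y - z) ->
    \pi_(presmod tens_rel) x =
    a *: (\pi_(presmod tens_rel) y : tens) + \pi_(presmod tens_rel) z.
  move=> xyz; rewrite -[a *: _]pi_presmodZ -pi_presmodD; apply/presmod_eq.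
  rewrite opprD addrA -[_ - z]addr0 -[_ - z]scale1r.
  by apply: rspanD xyz _; exact: rspan0.
split=> [cs a v v'|v s1 s2 a c c'].
  exact: (piE _ _ _ _ (tens_rel_head a v v' cs)).
exact: (piE _ _ _ _ (tens_rel_word a v s1 c c' s2)).
Qed.

End TensorSpace.

Implicit Types V W C A : gspace K.

(* t lies in the degree n part of V (x) C^{(x)l}. *)
Inductive thomog V C (n : int) (l : nat) : tens V C -> Prop :=
| thomog0 : thomog n l 0
| thomogD v d cs ds t of
    homog d v & hseq ds cs & size cs = l & d + sumz ds = n & thomog n l t :
    thomog n l (pure v cs + t).

(* g (x) 1 *)
Definition tmap V W C (g : V -> W) : tens V C -> tens W C :=
  tlift (fun v cs => pure (g v) cs).

(* u |-> v (x) s1 (x) u (x) s2 *)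
Definition tplug V C (v : V) (s1 s2 : seq C) :
    tens (gunit K) C -> tens V C :=
  tlift (fun (a : gunit K) s => pure (a *: v) (s1 ++ s ++ s2)).

(* 1_V (x) 1^{(x)p} (x) w (x) 1^{(x)r}, for w : C -> C^{(x)q} of degree d, on
   the words of length p + 1 + r. *)
Definition tinner V C (d : int) (p : nat) (w : C -> tens (gunit K) C) :
    tens V C -> tens V C :=
  tlift (fun v cs => tplug (ksgn d v) [seq ksgn d c | c <- take p cs]
                           (drop p.+1 cs) (w (nth 0 cs p))).

(* w (x) 1^{(x)c}, for w : V -> V (x) C^{(x)b} *)
Definition touter V C (w : V -> tens V C) : tens V C -> tens V C :=
  tlift (fun v cs => tlift (fun v' s => pure v' (s ++ cs)) (w v)).

End Tensors.

Section GradedDual.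
Variables (K : fieldType) (C : gspace K).

(* C^* is the sum of the Vect(C_{-n}, K): functionals vanishing on all but
   finitely many components. *)
Definition gdualb : {pred (C -> (K^o : lmodType K))} := fun phi =>
  `[< linear phi /\ exists S : seq int,
      forall n, n \notin S -> forall c, phi (gproj n c) = 0 >].

Lemma gdualb_submod : submod_closed gdualb.
Proof.
split=> [|a f g /asboolP[lf [S fS]] /asboolP[lg [T gT]]]; apply/asboolP.
  by split; [move=> a x y; rewrite scaler0 addr0 | exists [::]].
split=> [b x y|].
  change (a *: f (b *: x + y) + g (b *: x + y) =
          b *: (a *: f x + g x) + (a *: f y + g y)).
  rewrite lf lg !scalerDr !scalerA [a * b]mulrC -!addrA; congr (_ + _).
  by rewrite addrCA.
exists (S ++ T) => n; rewrite mem_cat negb_or => /andP[nS nT] c.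
change (a *: f (gproj n c) + g (gproj n c) = 0).
by rewrite fS // gT // scaler0 addr0.
Qed.

HB.instance Definition _ := GRing.isSubmodClosed.Build K (C -> (K^o : lmodType K))
  gdualb gdualb_submod.

Record gdual_car := GDual { gdual_val :> C -> (K^o : lmodType K);
                            gdual_valP : gdual_val \in gdualb }.
HB.instance Definition _ := [isSub for gdual_val].
HB.instance Definition _ := [Choice of gdual_car by <:].
HB.instance Definition _ := [SubChoice_isSubLmodule of gdual_car by <:].

Lemma gdual_linear (phi : gdual_car) : linear phi.
Proof. by have /asboolP[] := gdual_valP phi. Qed.

Lemma gdual_fin (phi : gdual_car) : exists S : seq int,
  forall n, n \notin S -> forall c, phi (gproj n c) = 0.
Proof. by have /asboolP[] := gdual_valP phi. Qed.

Lemma gdual_ext (phi psi : gdual_car) : (forall c, phi c = psi c) -> phi = psi.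
Proof. by move=> e; apply: val_inj; apply: funext. Qed.

Lemma gdual_proj_subproof (n : int) (phi : gdual_car) :
  (fun c => phi (gproj (- n) c)) \in gdualb.
Proof.
apply/asboolP; split=> [a x y|]; first by rewrite gproj_linear gdual_linear.
exists [:: - n] => m; rewrite inE eq_sym => /negbTE mn c.
by rewrite gprojK mn (linearP0 (gdual_linear phi)).
Qed.

Definition gdual_proj (n : int) (phi : gdual_car) : gdual_car :=
  GDual (gdual_proj_subproof n phi).

Lemma gdual_proj_linear n : linear (gdual_proj n).
Proof. by move=> a f g; apply: gdual_ext. Qed.

Lemma gdual_projK m n phi : gdual_proj m (gdual_proj n phi) =
  if m == n then gdual_proj n phi else 0.
Proof.
apply: gdual_ext => c /=; rewrite gprojK eqr_opp eq_sym.
by case: eqP => [->|] //; rewrite (linearP0 (gdual_linear phi)).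
Qed.

Lemma gdual_sumE (I : Type) (s : seq I) (F : I -> gdual_car) c :
  (\sum_(i <- s) F i : gdual_car) c = \sum_(i <- s) F i c.
Proof. by elim/big_rec2: _ => // i x y _ <-. Qed.

Lemma gdual_proj_sum phi : exists2 s : seq int,
  uniq s & phi = \sum_(n <- s) gdual_proj n phi.
Proof.
have [S phiS] := gdual_fin phi; exists (undup (map -%R S)).
  exact: undup_uniq.
apply: gdual_ext => c; rewrite gdual_sumE /=.
have [s us cE] := gproj_sum c.
have phiD x y : phi (x + y) = phi x + phi y.
  by have := gdual_linear phi 1 x y; rewrite !scale1r.
have phi0 := linearP0 (gdual_linear phi).
rewrite {1}cE (big_morph phi phiD phi0).
rewrite (bigID (mem S)) /= [X in _ + X]big1 ?addr0 => [|n /phiS//].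
rewrite -big_filter -[RHS](big_map -%R xpredT (fun n => phi (gproj n c))).
rewrite [RHS](bigID (mem s)) /= [X in _ = _ + X]big1 ?addr0; last first.
  by move=> n ns; rewrite (gproj_sum_notin cE).
rewrite -[RHS]big_filter; apply: perm_big; apply: uniq_perm.
- exact: filter_uniq.
- by apply: filter_uniq; rewrite map_inj_uniq ?undup_uniq //; exact: oppr_inj.
move=> n; rewrite !mem_filter andbC; congr (_ && _).
rewrite -[n in RHS]opprK mem_map; last exact: oppr_inj.
by rewrite mem_undup mem_map //; exact: oppr_inj.
Qed.

Definition gdual : gspace K :=
  GSpace gdual_proj_linear gdual_projK gdual_proj_sum.

(* (phi_1 (x) ... (x) phi_l)(c_1 (x) ... (x) c_l), with its Koszul sign:
   phi_2 (x) ... (x) phi_l is moved past c_1, and so on. *)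
Fixpoint kpair (Phi : seq gdual) (cs : seq C) {struct cs} : (K^o : lmodType K) :=
  match Phi, cs with
  | [::], [::] => 1
  | phi :: Phi', c :: cs' =>
      hsum (fun n (cn : C) =>
        ((phi : gdual_car) cn *
          kpair [seq ksgn n psi | psi <- Phi'] cs' : (K^o : lmodType K))) c
  | _, _ => 0
  end.

End GradedDual.

Section Evaluation.
Variables (K : fieldType) (C : gspace K).
Implicit Types (V : gspace K) (Phi : seq (gdual C)).

(* (1_V (x) Phi)(v (x) cs): Phi is moved past v. *)
Definition kact V Phi (v : V) (cs : seq C) : V :=
  hsum (fun n (vn : V) => kpair [seq ksgn n psi | psi <- Phi] cs *: vn) v.

Definition teval V Phi : tens V C -> V := tlift (kact Phi).

(* The canonical evaluation V (x) C^{(x)l} -> [D^{(x)l}, V], D the graded dual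
   of C, is the mate of V (x) C^{(x)l} (x) D^{(x)l} -> V.  Moving cs past Phi
   costs (-1)^{|cs||Phi|}, which is (-1)^{|Phi|} since only the cs of degree
   -|Phi| contribute. *)
Definition tcoeval V (t : tens V C) Phi : V :=
  tlift (fun v cs => kpair [seq ksgn 1 psi | psi <- Phi] cs *: v) t.

Lemma linear_scalel V (a : V) : linear (fun k : (K^o : lmodType K) => k *: a).
Proof. by move=> b x y; rewrite scalerDl scalerA. Qed.

Lemma kpair_linear Phi s1 s2 : linear (fun c => kpair Phi (s1 ++ c :: s2)).
Proof.
elim: s1 Phi => [|c0 s1 ih] [|phi Phi] a x y; rewrite ?scaler0 ?addr0 //=.
  apply: hsum_linear => n b u v /=.
  by rewrite gdual_linear mulrDl -scalerAl.
have [S uS c0S] := gproj_supp c0.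
have phi0 := linearP0 (gdual_linear phi).
rewrite !(hsumE (s := S)) //; try by move=> n; rewrite phi0 mul0r.
rewrite scaler_sumr -big_split /=; apply: eq_bigr => n _.
by rewrite ih mulrDr -scalerAr.
Qed.

Lemma kact_multilinear V Phi : multilinear (@kact V Phi).
Proof.
split=> [cs|v s1 s2 a x y].
  by apply: hsum_linear => n b u v; rewrite scalerDr !scalerA mulrC.
have [S uS vS] := gproj_supp v.
rewrite /kact !(hsumE (s := S)) //; try by move=> n; rewrite scaler0.
rewrite scaler_sumr -big_split /=; apply: eq_bigr => n _.
by rewrite kpair_linear scalerDl scalerA.
Qed.

Lemma ksgn_vanish (phi : gdual C) d n c :
  phi (gproj n c) = 0 -> (ksgn d phi : gdual C) (gproj n c) = 0.
Proof.
move=> phi0; have [S uS phiS] := gproj_supp phi.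
rewrite /ksgn (hsumE (s := S)) //; last by move=> m; rewrite scaler0.
rewrite gdual_sumE big1 // => m _.
change ((-1) ^ (d * m) *: phi (gproj (- m) (gproj n c)) = 0).
rewrite gprojK; case: eqP => _; first by rewrite phi0 scaler0.
by rewrite (linearP0 (gdual_linear phi)) scaler0.
Qed.

Lemma kpair_fin Phi : exists S : seq int, forall h : gdual C -> gdual C,
  (forall phi n c, (phi : gdual C) (gproj n c) = 0 -> h phi (gproj n c) = 0) ->
  forall ds cs, hseq ds cs -> sumz ds \notin S -> kpair (map h Phi) cs = 0.
Proof.
elim: Phi => [|phi Phi [S ih]].
  exists [:: 0] => h _ [|d ds] [|c cs] //= _.
  by rewrite /sumz big_nil inE eqxx.
have [T phiT] := gdual_fin phi.
exists [seq x + y | x <- T, y <- S] => h hP [|d ds] [|c cs] //= [dc hcs].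
rewrite /sumz big_cons => nS; rewrite (hsum_homog _ dc); last first.
  by move=> n; rewrite (linearP0 (gdual_linear _)) mul0r.
have [dT|dT] := boolP (d \in T); last by rewrite -dc hP ?mul0r //; exact: phiT.
rewrite -map_comp (ih _ _ _ _ hcs) ?mulr0 //.
  by move=> psi n c' /hP e; exact: ksgn_vanish.
by apply: contra nS => dS; apply/allpairsP; exists (d, sumz ds).
Qed.

Lemma teval_fin Phi : exists S : seq int, forall n l (t : tens (gunit K) C),
  thomog n l t -> n \notin S -> teval Phi t = 0.
Proof.
have [S PhiS] := kpair_fin Phi; exists S => n l t ht nS.
have lt := tlift_linear (kact_multilinear (gunit K) Phi).
elim: ht => [|a d cs ds t' da dcs _ dn _ ih]; first exact: (linearP0 lt).
rewrite /teval -[pure a cs]scale1r lt (tlift_pure _ _ (kact_multilinear _ _)).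
rewrite -[X in _ + X = 0]/(teval Phi t') ih addr0 scale1r.
rewrite /kact (hsum_homog _ da); last by move=> m; rewrite scaler0.
have [d0|d0] := eqVneq d 0; last first.
  by move: da; rewrite /homog /= (negbTE d0) => <-; rewrite scaler0.
rewrite (PhiS _ _ _ _ dcs) ?scale0r //.
  by move=> phi m c; exact: ksgn_vanish.
by move: nS; rewrite -dn d0 add0r.
Qed.

End Evaluation.

Section AinfAlgebras.
Variable K : fieldType.
Implicit Types A B : gspace K.

(* f_k is linear in each entry and of degree e k, for k >= 1. *)
Definition multimap A B (e : nat -> int) (f : seq A -> B) : Prop :=
  (forall s1 s2, linear (fun a => f (s1 ++ a :: s2))) /\
  (forall ds s, (0 < size s)%N -> hseq ds s ->
     homog (sumz ds + e (size s)) (f s)).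

(* (1^{(x)p} (x) m_q (x) 1^{(x)r})(s), as a word *)
Definition winner A (m : seq A -> A) (p q : nat) (s : seq A) : seq A :=
  [seq ksgn (2 - q%:Z) a | a <- take p s]
    ++ m (take q (drop p s)) :: drop (p + q) s.

Record ainf_algebra := AinfAlgebra {
  alg_car :> gspace K;
  alg_mul : seq alg_car -> alg_car;
  alg_mulP : multimap (fun k => 2 - k%:Z) alg_mul;
  alg_rel : forall s : seq alg_car, (0 < size s)%N ->
    \sum_(0 <= p < size s) \sum_(1 <= q < (size s - p).+1)
      ((-1) ^+ (p + q * (size s - p - q)) : K) *: alg_mul (winner alg_mul p q s)
    = 0
}.

(* The decompositions n = i_1 + ... + i_l, l >= 0, into positive parts. *)
Definition decomps (n : nat) : seq (seq nat) :=
  [seq i <- [seq map (@nat_of_ord n.+1) t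
            | l <- iota 0 n.+1, t <- map val (enum {: l.-tuple 'I_n.+1})]
  | all (leq 1) i && (sumn i == n)].

(* s = (l-1)(i_1-1) + (l-2)(i_2-1) + ... + (i_{l-1}-1) *)
Fixpoint dsign (i : seq nat) : nat :=
  if i is j :: i' then (size i' * j.-1 + dsign i')%N else 0%N.

(* (f_{i_1} (x) ... (x) f_{i_l})(s), as a word: f_{i_2} (x) ... (x) f_{i_l}, of
   degree (1-i_2) + ... + (1-i_l), is moved past the first i_1 entries. *)
Fixpoint blocks A B (f : seq A -> B) (i : seq nat) (s : seq A) : seq B :=
  if i is j :: i' then
    f [seq ksgn (sumz [seq 1 - k%:Z | k <- i']) a | a <- take j s]
      :: blocks f i' (drop j s)
  else [::].

Definition ainf_morphism A B (mA : seq A -> A) (mB : seq B -> B)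
    (f : seq A -> B) : Prop :=
  multimap (fun k => 1 - k%:Z) f /\
  forall s, (0 < size s)%N ->
    \sum_(0 <= p < size s) \sum_(1 <= q < (size s - p).+1)
      ((-1) ^+ (p + q * (size s - p - q)) : K) *: f (winner mA p q s)
    = \sum_(i <- decomps (size s))
        ((-1) ^+ dsign i : K) *: mB (blocks f i s).

Lemma mem_decomps n i : (i \in decomps n) = all (leq 1) i && (sumn i == n).
Proof.
rewrite mem_filter andb_idr // => /andP[i1 /eqP in_].
have le_size : (size i <= n)%N.
  rewrite -in_; elim: i i1 {in_} => //= j i ih /andP[j1 /ih le_i].
  by rewrite -add1n leq_add.
have ltn : all (fun j => j < n.+1)%N i.
  apply/allP => j ji; rewrite ltnS -in_ (perm_sumn (perm_to_rem ji)) /=.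
  exact: leq_addr.
apply/allpairsPdep; exists (size i), (map inord i); split.
- by rewrite mem_iota.
- apply/mapP; exists (map_tuple inord (in_tuple i)) => //.
  by rewrite mem_enum.
rewrite -map_comp map_id_in // => j ji /=.
by rewrite inordK //; exact: (allP ltn).
Qed.

Lemma decomps_uniq n : uniq (decomps n).
Proof.
apply: filter_uniq; apply: allpairs_uniq_dep.
- exact: iota_uniq.
- by move=> l _; rewrite map_inj_uniq ?enum_uniq //; exact: val_inj.
move=> [l t] [l' t'] /allpairsPdep[l1 [_ [_ /mapP[u _ ->]]]] + .
move=> [-> ->] /allpairsPdep[l2 [_ [_ /mapP[v _ ->]]]] [-> ->] /= e.
have e' : val u = val v by apply: inj_map e; exact: val_inj.
have e2 : l1 = l2 by rewrite -(size_tuple u) -(size_tuple v) e'.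
by rewrite e' e2.
Qed.

End AinfAlgebras.

Section AinfCoalgebras.
Variable K : fieldType.

(* w_k : C -> C^{(x)k}, k >= 1; coalg_w 0 is a dummy that is never used and may
   be taken to be 0. *)
Record ainf_coalgebra := AinfCoalgebra {
  coalg_car :> gspace K;
  coalg_w : nat -> coalg_car -> tens (gunit K) coalg_car;
  coalg_linear : forall k, linear (coalg_w k);
  coalg_degree : forall k n c,
    homog n c -> thomog (n + (2 - k%:Z)) k (coalg_w k c);
  coalg_rel : forall n c, (0 < n)%N ->
    \sum_(0 <= p < n) \sum_(1 <= q < (n - p).+1)
      ((-1) ^+ (p * q + (n - p - q)) : K) *:
        tinner (2 - q%:Z) p (coalg_w q) (coalg_w (p + 1 + (n - p - q)) c)
    = 0;
  coalg_fin : forall c, exists N, forall k, (N < k)%N -> coalg_w k c = 0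
}.

(* comod_w l is w^P_{l+1} : P -> P (x) C^{(x)l}. *)
Record ainf_comodule (C : ainf_coalgebra) := AinfComodule {
  comod_car :> gspace K;
  comod_w : nat -> comod_car -> tens comod_car C;
  comod_linear : forall l, linear (comod_w l);
  comod_degree : forall l n x,
    homog n x -> thomog (n + (2 - l.+1%:Z)) l (comod_w l x);
  comod_rel : forall n x, (0 < n)%N ->
    \sum_(1 <= p < n) \sum_(1 <= q < (n - p).+1)
      ((-1) ^+ (p * q + (n - p - q)) : K) *:
        tinner (2 - q%:Z) p.-1 (@coalg_w C q) (comod_w (p + (n - p - q)) x)
    + \sum_(1 <= b < n.+1)
      ((-1) ^+ (n - b) : K) *: touter (comod_w b.-1) (comod_w (n - b) x)
    = 0
}.

Definition comod_morphism (C : ainf_coalgebra) (P Q : ainf_comodule C)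
    (g : P -> Q) : Prop :=
  [/\ linear g, degree_preserving g &
      forall l x, tmap g (comod_w l x) = comod_w l (g x)].

(* A graded space with candidate structure maps; premod_op s x is
   m_{k+1}(s (x) x) for s of length k. *)
Record premodule (A : gspace K) := PreModule {
  premod_car :> gspace K;
  premod_op : seq A -> premod_car -> premod_car
}.

Definition is_ainf_module (A : ainf_algebra K) (M : premodule A) : Prop :=
  [/\ forall s, linear (@premod_op A M s),
      forall s1 s2 x, linear (fun a => @premod_op A M (s1 ++ a :: s2) x),
      forall ds s d (x : M), hseq ds s -> homog d x ->
        homog (sumz ds + d + (2 - (size s).+1%:Z)) (premod_op s x) &
      forall s (x : M),
        \sum_(0 <= p < size s) \sum_(1 <= q < (size s - p).+1)
          ((-1) ^+ (p + q * ((size s).+1 - p - q)) : K) *: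
            premod_op (winner (@alg_mul K A) p q s) x
        + \sum_(0 <= a < (size s).+1)
          ((-1) ^+ a : K) *:
            premod_op [seq ksgn (2 - ((size s).+1 - a)%N%:Z) c | c <- take a s]
                      (premod_op (drop a s) x)
        = 0].

Definition module_morphism (A : gspace K) (M N : premodule A) (g : M -> N) :
    Prop :=
  [/\ linear g, degree_preserving g &
      forall s x, g (premod_op s x) = premod_op s (g x)].

End AinfCoalgebras.

Section DualAlgebra.
Variables (K : fieldType) (C : ainf_coalgebra K).

(* (-1)^{k(|Phi|+1)} mu o Phi o w_k *)
Definition dual_mul_fun (Phi : seq (gdual C)) (c : C) : (K^o : lmodType K) :=
  ((-1) ^+ size Phi : K) *:
    (teval [seq ksgn (size Phi)%:Z phi | phi <- Phi] (coalg_w (size Phi) c)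
      : gunit K).

Lemma dual_mul_subproof Phi : dual_mul_fun Phi \in @gdualb K C.
Proof.
rewrite /dual_mul_fun; set k := size Phi; set Psi := map _ Phi.
have lE := tlift_linear (kact_multilinear (gunit K) Psi).
apply/asboolP; split=> [a x y|].
  rewrite coalg_linear /teval lE scalerDr !scalerA; congr (_ *: _ + _).
  exact: mulrC.
have [S PsiS] := teval_fin Psi; exists [seq s - (2 - k%:Z) | s <- S] => n nS c.
rewrite (PsiS (n + (2 - k%:Z)) k) ?scaler0 //.
  by apply: coalg_degree; rewrite /homog gprojK eqxx.
by apply: contra nS => nS; apply/mapP; exists (n + (2 - k%:Z)); rewrite ?addrK.
Qed.

Definition dual_mul (Phi : seq (gdual C)) : gdual C :=
  GDual (dual_mul_subproof Phi).

(* The left C^*-module structure of a right C-comodule. *)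
Definition dual_op (P : ainf_comodule C) (Phi : seq (gdual C)) (x : P) : P :=
  teval [seq ksgn (2 - (size Phi).+1%:Z) phi | phi <- Phi]
        (comod_w (size Phi) x).

End DualAlgebra.

Section Pairings.
Variables (K : fieldType) (C : ainf_coalgebra K) (A : ainf_algebra K).
Implicit Type f : seq A -> gdual C.

Definition pairing f : Prop := ainf_morphism (@alg_mul K A) (@dual_mul K C) f.

Definition restrict (e : seq nat -> nat) f (M : lmodType K)
    (op : seq (gdual C) -> M -> M) (s : seq A) (x : M) : M :=
  \sum_(i <- decomps (size s)) ((-1) ^+ e i : K) *: op (blocks f i s) x.

Definition iotaCA_with (e : seq nat -> nat) f (P : ainf_comodule C) :
    premodule A :=
  PreModule (restrict e f (@dual_op K C P)).

(* The sign carried by f_{i_1} (x) ... (x) f_{i_l} (x) 1_M in the rule for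
   morphisms, 1_M being counted as a last block of length 1: it is dsign i
   plus (i_1 - 1) + ... + (i_l - 1).  With dsign i alone the A_infinity-module
   relation fails: for s = [:: a; b] it needs
     f_1 m_2 - m_2(f_1 (x) f_1)
       + e (m_1 f_2 + f_2(m_1 (x) 1) + f_2(1 (x) m_1))
   to act by 0, where e is the sign of f_2 (x) 1_M, while the rule for
   morphisms makes this expression vanish for e = -1. *)
Definition module_sign (i : seq nat) : nat := dsign (rcons i 1%N).

Definition iotaCA f : ainf_comodule C -> premodule A :=
  iotaCA_with module_sign f.

(* iotaCA_with e f is the identity on underlying maps of morphisms: it is a
   functor, full and faithful, iff the two notions of morphism agree. *)
Definition full_embedding (e : seq nat -> nat) f : Prop :=
  (forall (P Q : ainf_comodule C) (g : P -> Q),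
     comod_morphism g <->
     @module_morphism K A (iotaCA_with e f P) (iotaCA_with e f Q) g) /\
  (forall P Q : ainf_comodule C, iotaCA_with e f P = iotaCA_with e f Q -> P = Q).

(* alpha f x s is the value on s of the image of the family x of elements of
   the V (x) C^{(x)l}. *)
Definition alpha f (V : gspace K) (x : nat -> tens V C) (s : seq A) : V :=
  \sum_(i <- decomps (size s))
    ((-1) ^+ dsign i : K) *: tcoeval (x (size i)) (blocks f i s).

(* Since f_i has degree 1 - i, the component A^{(x)k} -> D^{(x)l}, D the graded
   dual of C, of the map alpha precomposes with has degree l - k.  So alpha is a map of graded spaces for the
   total degree: degree d of the source is the product over l of the degree d - l
   parts of V (x) C^{(x)l}. *)
Definition rational f : Prop :=
  forall (V : gspace K) (d : int) (x y : nat -> tens V C),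
    (forall l, thomog (d - l%:Z) l (x l)) ->
    (forall l, thomog (d - l%:Z) l (y l)) ->
    (forall s, alpha f x s = alpha f y s) -> forall l, x l = y l.

End Pairings.

(* Main.v *)
(* After the shift s^{(x)k}, the signs of an A_infinity-structure become bare
   Koszul signs, and a morphism f of A_infinity-algebras becomes a morphism of
   differential graded tensor coalgebras.  Hence pulling functions of words back
   along f commutes with the coderivations, and the restriction along f of a
   module is a module.  The relation of the left C^*-module underlying a
   comodule is obtained by evaluating the relation of the comodule.

   On x of degree d, the structure maps of iota(C, A)(P) are, up to signs
   depending only on d and the number of arguments, the values of alpha on the
   family of the w_l(x) rescaled by signs depending only on d and l; this holds
   with either sign rule for the restriction of scalars.  So if alpha is
   injective, a degree-preserving linear map compatible with the module
   structures is compatible with the comodule structures, and, taking the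
   identity map, the module structure determines the comodule structure. *)
Require Import Defs.
From mathcomp Require Import all_boot all_order all_algebra ring.
From mathcomp Require Import generic_quotient finmap boolp monalg.

Set Implicit Arguments.
Unset Strict Implicit.
Unset Printing Implicit Defensive.

Import GRing.Theory.
Local Open Scope ring_scope.
Local Open Scope quotient_scope.

(** * Koszul signs *)

Section Parity.

(** Exponents of -1 are kept as booleans under [(+)], so that comparisons of signs end in a case
    analysis on parities. *)
Definition pz (d : int) : bool := odd `|d|%N.

Lemma pz_nat (n : nat) : pz n%:Z = odd n.
Proof. by []. Qed.

Lemma pzN d : pz (- d) = pz d.
Proof. by rewrite /pz abszN. Qed.

Lemma pzD m n : pz (m + n) = pz m (+) pz n.
Proof.
have aux (a b : nat) : pz (a%:Z - b%:Z) = odd a (+) odd b.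
  have [ab|ab] := leqP a b.
    by rewrite -pzN opprB subzn // pz_nat oddB // addbC.
  by rewrite subzn ?pz_nat ?oddB // ltnW.
case: m n => [a|a] [b|b]; rewrite ?NegzE.
- by rewrite -PoszD !pz_nat oddD.
- by rewrite aux pzN.
- by rewrite addrC aux pzN addbC.
- by rewrite -opprD -PoszD !pzN !pz_nat oddD.
Qed.

Lemma pzM m n : pz (m * n) = pz m && pz n.
Proof. by rewrite /pz abszM oddM. Qed.

Lemma signzE (K : fieldType) d : (-1) ^ d = (-1) ^+ pz d :> K.
Proof.
case: d => n; first by rewrite -exprnP /pz absz_nat signr_odd.
by rewrite NegzE -exprnN /pz abszN absz_nat -exprVn invrN1 signr_odd.
Qed.

End Parity.

(** * Linear maps as bare functions *)

Section Linear.
Variable K : fieldType.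

Lemma lin_add (U W : lmodType K) (F : U -> W) x y :
  linear F -> F (x + y) = F x + F y.
Proof. by move=> lF; have := lF 1 x y; rewrite !scale1r. Qed.

Lemma lin_scale (U W : lmodType K) (F : U -> W) a x :
  linear F -> F (a *: x) = a *: F x.
Proof. by move=> lF; have := lF a x 0; rewrite (linearP0 lF) !addr0. Qed.

Lemma lin_opp (U W : lmodType K) (F : U -> W) x : linear F -> F (- x) = - F x.
Proof. by move=> lF; rewrite -scaleN1r lin_scale // scaleN1r. Qed.

Lemma lin_sum (U W : lmodType K) (F : U -> W) I (r : seq I) (P : pred I) G :
  linear F -> F (\sum_(i <- r | P i) G i) = \sum_(i <- r | P i) F (G i).
Proof.
move=> lF; apply: (big_morph F); last exact: linearP0.
by move=> x y; exact: lin_add.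
Qed.

Lemma linear_bigsum (U W : lmodType K) I (r : seq I) (P : pred I) (G : I -> U -> W) :
  (forall i, P i -> linear (G i)) ->
  linear (fun x => \sum_(i <- r | P i) G i x).
Proof.
move=> lG a x y; rewrite scaler_sumr -big_split /=.
by apply: eq_bigr => i Pi; exact: lG.
Qed.

Lemma linear_scale (U W : lmodType K) (a : K) (F : U -> W) :
  linear F -> linear (fun x => a *: F x).
Proof. by move=> lF b x y; rewrite lF scalerDr !scalerA mulrC. Qed.

Lemma linear_comp (U V W : lmodType K) (F : V -> W) (G : U -> V) :
  linear F -> linear G -> linear (fun x => F (G x)).
Proof. by move=> lF lG a x y; rewrite lG lF. Qed.

End Linear.

Section Koszul.
Variable K : fieldType.
Implicit Types V W : gspace K.

Lemma homog_proj V n (v : V) : homog n (gproj n v).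
Proof. by rewrite /homog gprojK eqxx. Qed.

Lemma homog0 V n : homog n (0 : V).
Proof. exact: gproj0. Qed.

Lemma homogZ V n a (v : V) : homog n v -> homog n (a *: v).
Proof. by rewrite /homog (lin_scale _ _ (@gproj_linear _ _ _)) => ->. Qed.

Lemma homogD V n (v w : V) : homog n v -> homog n w -> homog n (v + w).
Proof. by rewrite /homog (lin_add _ _ (@gproj_linear _ _ _)) => -> ->. Qed.

Lemma homog_sum V n I (r : seq I) (P : pred I) (F : I -> V) :
  (forall i, P i -> homog n (F i)) -> homog n (\sum_(i <- r | P i) F i).
Proof.
move=> hF; apply: (big_ind (homog n)) => //; first exact: homog0.
by move=> x y; exact: homogD.
Qed.

Lemma ksgn_linear V d : linear (@ksgn K V d).
Proof. by apply: hsum_linear => n a u v; rewrite scalerDr !scalerA mulrC. Qed.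

Lemma ksgn_homog V d n (v : V) :
  homog n v -> ksgn d v = (-1) ^+ (pz d && pz n) *: v.
Proof.
by move=> hv; rewrite /ksgn (hsum_homog _ hv) ?signzE ?pzM // => m; rewrite scaler0.
Qed.

(** Every element is a finite sum of its homogeneous components, and on a homogeneous element [ksgn]
    is multiplication by a sign. *)
Lemma homog_ext V (U : lmodType K) (F G : V -> U) : linear F -> linear G ->
  (forall n v, homog n v -> F v = G v) -> F =1 G.
Proof.
move=> lF lG FG v; have [s _ ->] := gproj_sum v.
rewrite !lin_sum //; apply: eq_bigr => n _; apply: (FG n).
exact: homog_proj.
Qed.

Lemma ksgnK V d e (v : V) : ksgn d (ksgn e v) = ksgn (d + e) v.
Proof.
move: v; apply: homog_ext; last first.
- move=> n v hv; rewrite (ksgn_homog e hv) (lin_scale _ _ (@ksgn_linear _ _)).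
  rewrite !(ksgn_homog _ hv) scalerA -signr_addb pzD.
  congr (_ ^+ (nat_of_bool _) *: _).
  by case: (pz d); case: (pz e); case: (pz n).
- exact: ksgn_linear.
- by apply: linear_comp; exact: ksgn_linear.
Qed.

Lemma eq_ksgn V d e (v : V) : pz d = pz e -> ksgn d v = ksgn e v.
Proof.
move=> de; move: v; apply: homog_ext; try exact: ksgn_linear.
by move=> n v hv; rewrite !(ksgn_homog _ hv) de.
Qed.

Lemma ksgn_even V d (v : V) : pz d = false -> ksgn d v = v.
Proof.
move=> d0; move: v; apply: homog_ext; [exact: ksgn_linear | by [] |].
by move=> n v hv; rewrite (ksgn_homog _ hv) d0 scale1r.
Qed.

Lemma homog_ksgn V d n (v : V) : homog n v -> homog n (ksgn d v).
Proof. by move=> hv; rewrite (ksgn_homog _ hv); exact: homogZ. Qed.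

Lemma hseq_cat V ds1 ds2 (s1 s2 : seq V) :
  hseq ds1 s1 -> hseq ds2 s2 -> hseq (ds1 ++ ds2) (s1 ++ s2).
Proof. by elim: ds1 s1 => [|d ds1 ih] [|v s1] //= [hv /ih h] /h. Qed.

Lemma hseq_catP V ds (s1 s2 : seq V) : hseq ds (s1 ++ s2) ->
  exists ds1 ds2, [/\ ds = ds1 ++ ds2, hseq ds1 s1 & hseq ds2 s2].
Proof.
elim: s1 ds => [|v s1 ih] [|d ds] //=.
- by exists [::], [::].
- by move=> h; exists [::], (d :: ds).
by case=> hv /ih [ds1 [ds2 [-> h1 h2]]]; exists (d :: ds1), ds2.
Qed.

Lemma hseq_size V ds (s : seq V) : hseq ds s -> size ds = size s.
Proof. by elim: ds s => [|d ds ih] [|v s] //= [_ /ih ->]. Qed.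

Lemma hseq_map V (h : V -> V) ds s :
  (forall n v, homog n v -> homog n (h v)) -> hseq ds s -> hseq ds (map h s).
Proof. by move=> hh; elim: ds s => [|d ds ih] [|v s] //= [/hh ? /ih]. Qed.

Lemma sumz_cat ds1 ds2 : sumz (ds1 ++ ds2) = sumz ds1 + sumz ds2.
Proof. exact: big_cat. Qed.

Lemma sumz_cons d ds : sumz (d :: ds) = d + sumz ds.
Proof. exact: big_cons. Qed.

Lemma sumz_nil : sumz [::] = 0.
Proof. exact: big_nil. Qed.

End Koszul.

(** * Multilinear functions of words *)

Section MultilinearWords.
Variable K : fieldType.
Implicit Types A B : gspace K.

Definition wlinear (A U : lmodType K) (G : seq A -> U) : Prop :=
  forall s1 s2, linear (fun a => G (s1 ++ a :: s2)).

Lemma wlinear_prefix (A U : lmodType K) (G : seq A -> U) s :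
  wlinear G -> wlinear (fun t => G (s ++ t)).
Proof.
move=> lG s1 s2 a x y; have := lG (s ++ s1) s2 a x y.
by rewrite -!catA.
Qed.

Lemma wlinear_cons (A U : lmodType K) (G : seq A -> U) a :
  wlinear G -> wlinear (fun t => G (a :: t)).
Proof. exact: (@wlinear_prefix A U G [:: a]). Qed.

Lemma wlinear_comp (A U W : lmodType K) (G : seq A -> U) (h : U -> W) :
  linear h -> wlinear G -> wlinear (fun t => h (G t)).
Proof. by move=> lh lG s1 s2; apply: linear_comp => //; exact: lG. Qed.

Lemma wlinear_map (A U : lmodType K) (G : seq A -> U) (h : A -> A) :
  linear h -> wlinear G -> wlinear (fun t => G (map h t)).
Proof.
move=> lh lG s1 s2 a x y; rewrite !map_cat /= lh; exact: lG.
Qed.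

Lemma wlinear_ext A (U : lmodType K) (G H : seq A -> U) (n : nat) :
  wlinear G -> wlinear H ->
  (forall ds s, size s = n -> hseq ds s -> G s = H s) ->
  forall s, size s = n -> G s = H s.
Proof.
move=> lG lH GH.
(* Induction on the suffix [s2] still to be expanded; the letters of [s1] have already been replaced
   by homogeneous ones. *)
suff ext s2 : forall ds s1, hseq ds s1 -> (size (s1 ++ s2) = n) ->
    G (s1 ++ s2) = H (s1 ++ s2).
  by move=> s sn; exact: (ext s [::] [::]).
elim: s2 => [|a s2 ih] ds s1 h1 sn.
  by apply: (GH ds) => //; rewrite cats0.
have [s _ ->] := gproj_sum a.
rewrite (lin_sum _ _ _ (lG s1 s2)) (lin_sum _ _ _ (lH s1 s2)).
apply: eq_bigr => m _; rewrite -!cat_rcons; apply: (ih (rcons ds m)).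
  by rewrite -!cats1; apply: hseq_cat => //=; split=> //; exact: homog_proj.
by rewrite cat_rcons -sn !size_cat.
Qed.

Lemma wlinear_ksgn A (U : lmodType K) (G : seq A -> U) d ds s : wlinear G ->
  hseq ds s -> G (map (ksgn d) s) = (-1) ^+ (pz d && pz (sumz ds)) *: G s.
Proof.
elim: ds s G => [|n ds ih] [|a s] //= G lG; first by rewrite sumz_nil andbF scale1r.
move=> [ha hs]; have /= := ih s (fun t => G (ksgn d a :: t)) (wlinear_cons _ lG) hs.
rewrite (ksgn_homog _ ha) => ->.
rewrite (lin_scale _ _ (lG [::] s)) /= scalerA -signr_addb sumz_cons pzD.
by congr (_ ^+ (nat_of_bool _) *: _); case: pz; case: pz; case: pz.
Qed.

Lemma wlinear_opp (A U : lmodType K) (G : seq A -> U) s : wlinear G ->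
  G (map -%R s) = (-1) ^+ size s *: G s.
Proof.
elim: s G => [|a s ih] G lG /=; first by rewrite scale1r.
rewrite (ih (fun t => G (- a :: t))); last exact: wlinear_cons.
by rewrite (lin_opp _ (lG [::] s)) exprS mulN1r scaleNr scalerN.
Qed.

(** The degree of [f s] exceeds that of [s] by [e (size s)]: an operator moved past [f s] passes the
    letters of [s] and also [f] itself. *)
Lemma multimap_ksgn A B e (f : seq A -> B) d s : multimap e f ->
  (0 < size s)%N ->
  ksgn d (f s) = (-1) ^+ (pz d && pz (e (size s))) *: f (map (ksgn d) s).
Proof.
move=> [lf df] s0; apply: (wlinear_ext
  (G := fun t => ksgn d (f t))
  (H := fun t => (-1) ^+ (pz d && pz (e (size s))) *: f (map (ksgn d) t))
  (n := size s)) => //.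
- by apply: wlinear_comp => //; exact: ksgn_linear.
- move=> s1 s2; apply: linear_scale; apply: wlinear_map => //.
  exact: ksgn_linear.
move=> ds t tn ht; have t0 : (0 < size t)%N by rewrite tn.
rewrite (ksgn_homog _ (df _ _ t0 ht)).
rewrite (wlinear_ksgn _ lf ht) scalerA -signr_addb pzD tn.
by congr (_ ^+ (nat_of_bool _) *: _); case: pz; case: pz; case: pz.
Qed.

End MultilinearWords.

(** * Functions of words *)

Section Splits.
Variables (A : Type) (U : zmodType).
Implicit Types (H : seq A -> seq A -> U) (s : seq A).

(** The dual of deconcatenation, the coproduct of the tensor coalgebra, acting on functions of two
    words. *)
Definition splits H s : U :=
  \sum_(0 <= j < (size s).+1) H (take j s) (drop j s).

Lemma splits_nil H : splits H [::] = H [::] [::].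
Proof. by rewrite /splits big_nat1. Qed.

Lemma splits_cons H a s :
  splits H (a :: s) = H [::] (a :: s) + splits (fun u v => H (a :: u) v) s.
Proof. by rewrite /splits big_nat_recl. Qed.

Lemma eq_splits H H' s : (forall u v, u ++ v = s -> H u v = H' u v) ->
  splits H s = splits H' s.
Proof. by move=> HH'; apply: eq_bigr => j _; rewrite HH' // cat_take_drop. Qed.

Lemma splitsD H H' s :
  splits (fun u v => H u v + H' u v) s = splits H s + splits H' s.
Proof. exact: big_split. Qed.

(** Coassociativity of deconcatenation. *)
Lemma splitsA (H : seq A -> seq A -> seq A -> U) s :
  splits (fun u v => splits (fun u' v' => H u u' v') v) s =
  splits (fun w v => splits (fun u1 u2 => H u1 u2 v) w) s.
Proof.
elim: s H => [|a s ih] H; first by rewrite !splits_nil.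
rewrite !splits_cons splits_nil ih -addrA; congr (_ + _).
rewrite -splitsD; apply: eq_splits => u v _.
by rewrite splits_cons.
Qed.

End Splits.

(* The operator dual to the coderivation of the tensor coalgebra induced by b,
   acting on functions of words. *)
Section Coderivation.
Variables (A : Type) (U : zmodType) (J : A -> A) (b : seq A -> A).
Implicit Types (G : seq A -> U) (H : seq A -> seq A -> U) (s : seq A).

Definition coder G s : U :=
  \sum_(0 <= p < size s) \sum_(1 <= q < (size s - p).+1)
    G (map J (take p s) ++ b (take q (drop p s)) :: drop (p + q) s).

Lemma coder_nil G : coder G [::] = 0.
Proof. by rewrite /coder big_geq. Qed.

Lemma coder_cons G a s : coder G (a :: s) =
  splits (fun u v => G (b (a :: u) :: v)) s + coder (fun t => G (J a :: t)) s.
Proof. by rewrite /coder big_nat_recl //= subn0 big_add1. Qed.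

Lemma eq_coder G G' s : (forall t, G t = G' t) -> coder G s = coder G' s.
Proof. by move=> GG'; apply: eq_bigr => p _; apply: eq_bigr => q _. Qed.

Lemma coderD G G' s : coder (fun t => G t + G' t) s = coder G s + coder G' s.
Proof.
by rewrite -big_split; apply: eq_bigr => p _; rewrite big_split.
Qed.

(** The Leibniz rule, dual to the compatibility of a coderivation with deconcatenation; [J] is the
    price of passing the left factor. *)
Lemma coder_splits H s : coder (splits H) s =
  splits (fun u v => coder (H^~ v) u + coder (H (map J u)) v) s.
Proof.
elim: s H => [|a s ih] H; first by rewrite splits_nil !coder_nil addr0.
rewrite coder_cons splits_cons coder_nil add0r [coder (H _) _]coder_cons.
rewrite (eq_splits (H' := fun u v => H [::] (b (a :: u) :: v) +
  splits (fun u' v' => H (b (a :: u) :: u') v') v)); last first.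
  by move=> u v _; rewrite splits_cons.
rewrite (@eq_coder _ (fun t => H [::] (J a :: t) +
  splits (fun u v => H (J a :: u) v) t)); last first.
  by move=> t; rewrite splits_cons.
rewrite coderD splitsD ih (splitsA (fun u u' v' => H (b (a :: u) :: u') v')).
rewrite addrACA -splitsD; congr (_ + _); apply: eq_splits => u v _ /=.
by rewrite coder_cons addrA.
Qed.

End Coderivation.

(** * Decompositions into positive parts and pullback *)

Section Decompositions.

Lemma decompsS n : perm_eq (decomps n.+1)
  [seq j.+1 :: i | j <- iota 0 n.+1, i <- decomps (n - j)].
Proof.
apply: uniq_perm; first exact: decomps_uniq.
  apply: allpairs_uniq_dep; first exact: iota_uniq.
    by move=> j _; exact: decomps_uniq.
  by move=> [j i] [j' i'] _ _ [-> ->].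
move=> i; rewrite mem_decomps; apply/idP/allpairsPdep.
  case: i => [|[|j] i] //= /andP[i1 /eqP ni]; exists j, i.
  move: ni; rewrite addSn => -[<-]; split=> //.
    by rewrite -[_ :: _]/(iota 0 (j + sumn i).+1) mem_iota add0n ltnS leq_addr.
  by rewrite mem_decomps i1 addKn /=.
move=> [j [i' [jn]]]; rewrite mem_decomps => /andP[i1 /eqP ni] -> /=.
rewrite i1 ni /= addSn subnKC // -ltnS.
by rewrite mem_iota in jn.
Qed.

Lemma decomps0 : decomps 0 = [:: [::]].
Proof.
apply: perm_small_eq => //.
apply: uniq_perm => //; first exact: decomps_uniq.
by move=> [|[|j] i]; rewrite mem_decomps inE /= ?addSn ?andbF.
Qed.

End Decompositions.

(* Pullback of functions of words along the morphism of tensor coalgebras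
   with components F. *)
Section Pullback.
Variables (A B : Type) (U : zmodType) (F : seq A -> B).
Implicit Types (G : seq B -> U) (s : seq A).

Fixpoint cut (i : seq nat) s : seq B :=
  if i is j :: i' then F (take j s) :: cut i' (drop j s) else [::].

Definition pull G s : U := \sum_(i <- decomps (size s)) G (cut i s).

Lemma pull_nil G : pull G [::] = G [::].
Proof. by rewrite /pull decomps0 big_seq1. Qed.

Lemma pull_cons G a s : pull G (a :: s) =
  splits (fun u v => pull (fun t => G (F (a :: u) :: t)) v) s.
Proof.
rewrite /pull (perm_big _ (decompsS _)) big_allpairs_dep /splits /index_iota subn0.
apply: eq_big_seq => j; rewrite mem_iota => /andP[_ js].
by rewrite size_drop.
Qed.

(** All parts of a decomposition are positive, so [F] only meets nonempty blocks, and on those it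
    intertwines [JA] and [JB]. *)
Lemma pull_map (JA : A -> A) (JB : B -> B) G s :
  (forall a t, F (map JA (a :: t)) = JB (F (a :: t))) ->
  pull G (map JA s) = pull (fun t => G (map JB t)) s.
Proof.
move=> FJ; rewrite /pull size_map; apply: eq_big_seq => i.
rewrite mem_decomps => /andP[i1 /eqP si]; congr (G _).
elim: i s i1 si => //= -[//|j] i ih [//|a s] /= i1 [si].
rewrite -map_take FJ -map_drop ih //.
by rewrite size_drop -si addKn.
Qed.

Lemma eq_pull G G' s : (forall t, G t = G' t) -> pull G s = pull G' s.
Proof. by move=> GG'; apply: eq_bigr => i _. Qed.

Lemma pullD G G' s : pull (fun t => G t + G' t) s = pull G s + pull G' s.
Proof. exact: big_split. Qed.

End Pullback.

(** A morphism of tensor coalgebras respects deconcatenation: cutting a word into blocks and then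
    separating the blocks amounts to separating the word first and cutting both pieces. The length
    is only bounded by [n], since removing the first block leaves an arbitrary shorter suffix. *)
Lemma pull_splits (A B : Type) (U : zmodType) (F : seq A -> B)
    (H : seq B -> seq B -> U) s :
  pull F (splits H) s = splits (fun u v => pull F (fun t => pull F (H t) v) u) s.
Proof.
move: {2}(size s) (leqnn (size s)) => n.
elim: n s H => [|n ih] [|a s] H //= sn; try by rewrite !(splits_nil, pull_nil).
rewrite pull_cons splits_cons pull_nil pull_cons.
rewrite (eq_splits (H' := fun u v => pull F (fun t => H [::] (F (a :: u) :: t)) v +
  splits (fun u' v' => pull F (fun t => pull F (H (F (a :: u) :: t)) v') u') v)).
  rewrite splitsD; congr (_ + _); rewrite splitsA; apply: eq_splits => u v _.
  by rewrite pull_cons.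
move=> u v uv; rewrite -ih; last first.
  by rewrite -ltnS (leq_trans _ sn) // ltnS -uv size_cat leq_addl.
by rewrite -pullD; apply: eq_pull => t; rewrite splits_cons.
Qed.

Lemma linear_pull (K : fieldType) (A B : Type) (F : seq A -> B)
    (U W : lmodType K) (h : U -> W) (G : seq B -> U) s :
  linear h -> h (pull F G s) = pull F (fun t => h (G t)) s.
Proof. exact: lin_sum. Qed.

Lemma linear_coder (K : fieldType) (A : Type) (J : A -> A) (b : seq A -> A)
    (U W : lmodType K) (h : U -> W) (G : seq A -> U) s :
  linear h -> h (coder J b G s) = coder J b (fun t => h (G t)) s.
Proof.
by move=> lh; rewrite lin_sum //; apply: eq_bigr => p _; rewrite lin_sum.
Qed.

(* A morphism of A_infinity-algebras is a morphism of differential graded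
   tensor coalgebras: pulling back commutes with the coderivations. *)
Lemma coder_pull (K : fieldType) (A B U : lmodType K)
    (JA : A -> A) (bA : seq A -> A) (JB : B -> B) (bB : seq B -> B)
    (F : seq A -> B) (G : seq B -> U) s :
  (forall a s, F (map JA (a :: s)) = JB (F (a :: s))) ->
  (forall a s, coder JA bA F (a :: s) = pull F bB (a :: s)) ->
  wlinear G ->
  coder JA bA (pull F G) s = pull F (coder JB bB G) s.
Proof.
move=> FJ Fb; move: {2}(size s) (leqnn (size s)) => n.
elim: n s G => [|n ih] [|a s] G //= sn lG;
  try by rewrite pull_nil !coder_nil.
rewrite coder_cons pull_cons.
pose H x u v := pull F (fun t => G (F (x :: u) :: t)) v.
rewrite [X in X + _](_ : _ =
    splits (fun u v => splits (H (bA (a :: u))) v) s); last first.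
  by apply: eq_splits => u v _; rewrite pull_cons.
rewrite [X in _ + X](_ : _ = coder JA bA (splits (H (JA a))) s); last first.
  by apply: eq_coder => t; rewrite pull_cons.
(* On the left, [bA] acts either inside the block that [F] sends to the first letter or to the right
   of that block. *)
rewrite coder_splits splitsA splitsD addrA -splitsD.
rewrite [X in _ = X](_ : _ = splits (fun u v => pull F (fun t =>
    splits (fun t1 t2 => G (bB (F (a :: u) :: t1) :: t2)) t) v) s +
    splits (fun u v => pull F (coder JB bB
      (fun t => G (JB (F (a :: u)) :: t))) v) s); last first.
  rewrite -splitsD; apply: eq_splits => u v _; rewrite -pullD.
  by apply: eq_pull => t; rewrite coder_cons.
(* Operators to the right of the first block match by induction; those reaching the first letter
   remain. *)
congr (_ + _); last first.
  apply: eq_splits => u v uv; rewrite /H -FJ ih //.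
    by rewrite -ltnS (leq_trans _ sn) // ltnS -uv size_cat leq_addl.
  exact: wlinear_cons.
rewrite [RHS](_ : _ = splits (fun u v => splits (fun v1 v2 => pull F (fun t1 =>
    pull F (fun t2 => G (bB (F (a :: u) :: t1) :: t2)) v2) v1) v) s); last first.
  by apply: eq_splits => u v _; rewrite pull_splits.
rewrite splitsA; apply: eq_splits => w v _.
(* The terms with [bA] inside [a :: w] add up to the coderivation applied to [F], to which [Fb]
   applies; linearity of [G] in its first letter moves the sums in and out. *)
transitivity (pull F (fun t => G (coder JA bA F (a :: w) :: t)) v).
  rewrite -[LHS](coder_cons JA bA (fun u => pull F (fun t => G (F u :: t)) v)).
  rewrite (linear_coder JA bA F _ (h := fun x => pull F (fun t => G (x :: t)) v)) //.
  apply: (linear_bigsum _ (G := fun i x => G (x :: cut F i v))) => i _.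
  exact: (lG [::]).
rewrite Fb (linear_pull F bB _ (h := fun x => pull F (fun t => G (x :: t)) v)).
  by rewrite pull_cons.
apply: (linear_bigsum _ (G := fun i x => G (x :: cut F i v))) => i _.
exact: (lG [::]).
Qed.

(** * The shift *)

Section Shift.
Variable K : fieldType.
Implicit Types A B : gspace K.

(* The Koszul sign of an operator of degree 1 moved past sa, where the shift
   lowers degrees by 1: it is (-1)^{|a|-1}. *)
Definition sgn1 A (a : A) : A := - ksgn 1 a.

(* s^{(x)k}(a_1 (x) ... (x) a_k) = tw [:: a_1; ...; a_k]: composing operations
   with tw turns the signs of A_infinity-algebra into bare Koszul signs. *)
Fixpoint tw A (s : seq A) : seq A :=
  if s is a :: s' then ksgn (size s')%:Z a :: tw s' else [::].

Lemma map_ksgnK A d e (s : seq A) :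
  map (ksgn d) (map (ksgn e) s) = map (ksgn (d + e)) s.
Proof. by rewrite -map_comp; apply: eq_map => a /=; exact: ksgnK. Qed.

Lemma eq_map_ksgn A d e (s : seq A) :
  pz d = pz e -> map (ksgn d) s = map (ksgn e) s.
Proof. by move=> de; apply: eq_map => a; exact: eq_ksgn. Qed.

Lemma map_ksgn_even A d (s : seq A) : pz d = false -> map (ksgn d) s = s.
Proof. by move=> d0; apply: map_id_in => a _; exact: ksgn_even. Qed.

Lemma map_sgn1 A (s : seq A) : map (@sgn1 A) s = map -%R (map (ksgn 1) s).
Proof. by rewrite -map_comp. Qed.

Lemma map_ksgn_opp A d (s : seq A) :
  map (ksgn d) (map -%R s) = map -%R (map (ksgn d) s).
Proof.
rewrite -!map_comp; apply: eq_map => a /=.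
by rewrite (lin_opp _ (@ksgn_linear _ _ d)).
Qed.

Lemma size_tw A (s : seq A) : size (tw s) = size s.
Proof. by elim: s => //= a s ->. Qed.

Lemma tw_cat A (s1 s2 : seq A) :
  tw (s1 ++ s2) = map (ksgn (size s2)%:Z) (tw s1) ++ tw s2.
Proof.
by elim: s1 => //= a s1 ->; rewrite ksgnK size_cat addnC PoszD.
Qed.

Lemma tw_ksgn A d (s : seq A) : tw (map (ksgn d) s) = map (ksgn d) (tw s).
Proof. by elim: s => //= a s ->; rewrite !ksgnK addrC size_map. Qed.

Lemma tw_opp A (s : seq A) : tw (map -%R s) = map -%R (tw s).
Proof.
elim: s => //= a s ->; rewrite size_map.
by rewrite (lin_opp _ (@ksgn_linear _ _ _)).
Qed.

Lemma twK A : involutive (@tw A).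
Proof.
elim=> //= a s ih; rewrite ih ksgnK size_tw ksgn_even //.
by rewrite pzD addbb.
Qed.

Lemma wlinear_tw A (U : lmodType K) (G : seq A -> U) :
  wlinear G -> wlinear (fun t => G (tw t)).
Proof.
move=> lG s1 s2 a x y; rewrite !tw_cat /= ksgn_linear; exact: lG.
Qed.

Lemma wlinear_suffix A (U : lmodType K) (G : seq A -> U) s :
  wlinear G -> wlinear (fun t => G (t ++ s)).
Proof.
by move=> lG s1 s2 a x y; have := lG s1 (s2 ++ s) a x y; rewrite -!catA.
Qed.

Lemma wlinear_scale_at A (U : lmodType K) (G : seq A -> U) s1 a x s2 :
  wlinear G -> G (s1 ++ (a *: x) :: s2) = a *: G (s1 ++ x :: s2).
Proof. by move=> lG; rewrite (lin_scale _ _ (lG s1 s2)). Qed.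

Section Winner.
Variables (A : gspace K) (m : seq A -> A).
Hypothesis mP : multimap (fun k => 2 - k%:Z) m.

(** With p, q, r the three lengths, (-1)^p is the minus sign in [sgn1], and (-1)^{qr} comes from
    moving the twist by [size t3] past [m], whose degree has the parity of q. The remaining twists
    of [t1] agree modulo 2. *)
Lemma winner_tw (U : lmodType K) (G : seq A -> U) t1 t2 t3 :
  wlinear G -> (0 < size t2)%N ->
  (-1) ^+ (size t1 + size t2 * size t3) *:
     G (winner m (size t1) (size t2) (tw (t1 ++ t2 ++ t3))) =
  G (tw (map (@sgn1 A) t1 ++ m (tw t2) :: t3)).
Proof.
move=> lG t20; rewrite !tw_cat /= map_sgn1 tw_opp tw_ksgn map_ksgn_opp.
rewrite map_ksgnK /winner.
have tk (X Y Z : seq A) : size X = size t1 -> size Y = size t2 ->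
    (take (size t1) (X ++ Y ++ Z) = X) *
    (take (size t2) (drop (size t1) (X ++ Y ++ Z)) = Y) *
    (drop (size t1 + size t2) (X ++ Y ++ Z) = Z).
  move=> <- <-; rewrite take_size_cat // drop_size_cat // take_size_cat //.
  by rewrite addnC -drop_drop drop_size_cat // drop_size_cat.
have [h1 h2] : size (map (ksgn (size (t2 ++ t3))%:Z) (tw t1)) = size t1 /\
    size (map (ksgn (size t3)%:Z) (tw t2)) = size t2.
  by rewrite !size_map !size_tw.
rewrite !(tk _ _ _ h1 h2) map_ksgnK.
set x := m (map _ _).
rewrite (multimap_ksgn _ mP) ?size_tw // -/x.
rewrite wlinear_scale_at //.
have := wlinear_opp (map (ksgn ((size t3).+1%:Z + 1)) (tw t1))
  (wlinear_suffix (x :: tw t3) lG).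
rewrite /= size_map size_tw => ->.
rewrite (@eq_map_ksgn _ _ ((size t3).+1%:Z + 1)); last first.
  by rewrite size_cat PoszD !(pzD, pzN, pz_nat) /=; case: odd; case: odd.
rewrite scalerA exprD; congr (_ *: _); rewrite mulrC; congr (_ * _).
rewrite -signr_odd !(pzD, pzN, pz_nat) oddM /= andbC.
by case: odd; case: odd.
Qed.

Lemma coder_winner (U : lmodType K) (G : seq A -> U) t : wlinear G ->
  \sum_(0 <= p < size t) \sum_(1 <= q < (size t - p).+1)
     ((-1) ^+ (p + q * (size t - p - q)) : K) *: G (winner m p q (tw t)) =
  coder (@sgn1 A) (fun s => m (tw s)) (fun s => G (tw s)) t.
Proof.
move=> lG; apply: eq_big_nat => p /andP[_ pt]; apply: eq_big_nat => q /andP[q0].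
rewrite ltnS => qt.
have s1 : size (take p t) = p by rewrite size_takel // ltnW.
have s2 : size (take q (drop p t)) = q by rewrite size_takel // size_drop.
have s3 : size (drop (p + q) t) = (size t - p - q)%N by rewrite size_drop subnDA.
have tE : t = take p t ++ take q (drop p t) ++ drop (p + q) t.
  by rewrite addnC -drop_drop !cat_take_drop.
rewrite -(winner_tw _ _ lG) ?s2 // s1 s3; by rewrite -tE.
Qed.

Lemma winner_ksgn1 (U : lmodType K) (G : seq A -> U) p q u : wlinear G ->
  (0 < q)%N -> (q <= size u - p)%N ->
  (-1) ^+ q *: G (map (ksgn 1) (winner m p q u)) =
  G (winner m p q (map (ksgn 1) u)).
Proof.
move=> lG q0 qu.
have s2 : size (take q (drop p u)) = q by rewrite size_takel // size_drop.
rewrite /winner map_cat /= -!map_drop -!map_take.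
rewrite (multimap_ksgn _ mP) ?s2 // wlinear_scale_at // scalerA !map_ksgnK.
rewrite [2 - _ + 1]addrC !(pzD, pzN, pz_nat) /= -[(-1) ^+ q]signr_odd.
by rewrite -signr_addb addbb scale1r.
Qed.

(** The version for modules: the module entry is one more letter on the right. It raises r by one,
    and the resulting (-1)^q is the cost of moving the extra [ksgn 1] past [m]. *)
Lemma coder_winner1 (U : lmodType K) (G : seq A -> U) t : wlinear G ->
  \sum_(0 <= p < size t) \sum_(1 <= q < (size t - p).+1)
     ((-1) ^+ (p + q * ((size t).+1 - p - q)) : K) *:
       G (winner m p q (map (ksgn 1) (tw t))) =
  coder (@sgn1 A) (fun s => m (tw s)) (fun s => G (map (ksgn 1) (tw s))) t.
Proof.
move=> lG; rewrite -(@coder_winner _ (fun s => G (map (ksgn 1) s))); last first.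
  by apply: wlinear_map => //; exact: ksgn_linear.
apply: eq_big_nat => p /andP[_ pt]; apply: eq_big_nat => q /andP[q0].
rewrite ltnS => qt; rewrite -winner_ksgn1 ?size_tw // scalerA -exprD.
rewrite subSn ?(ltnW pt) // subSn // -[in LHS]signr_odd -[in RHS]signr_odd.
congr (_ ^+ nat_of_bool _ *: _).
by rewrite mulnS !oddD; case: odd; case: odd; case: odd.
Qed.

End Winner.

Section Blocks.
Variables (A B : gspace K) (f : seq A -> B).
Hypothesis fP : multimap (fun k => 1 - k%:Z) f.

(** For positive parts, minus the degree of f_{i_1} (x) ... (x) f_{i_l}. *)
Definition excess (i : seq nat) : nat := sumn (map predn i).

Lemma sumz_blocks i : all (leq 1) i ->
  sumz [seq 1 - k%:Z | k <- i] = (size i)%:Z - (sumn i)%:Z.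
Proof.
elim: i => [|j i ih] /=; first by rewrite sumz_nil.
move=> /andP[_ /ih]; rewrite sumz_cons => ->.
by rewrite PoszD -addn1 PoszD; ring.
Qed.

(** The number [e] counts letters standing to the right of the word: 0 over the algebra alone, 1
    when a module entry follows. A block of length j has degree 1 - j, and passing it over the
    output letters to its right gives the sign. *)
Lemma blocks_tw (U : lmodType K) (G : seq B -> U) (e : nat) i t :
  wlinear G -> all (leq 1) i -> sumn i = size t ->
  (-1) ^+ (dsign i + e * excess i) *: G (blocks f i (map (ksgn e%:Z) (tw t))) =
  G (map (ksgn e%:Z) (tw (cut (fun s => f (tw s)) i t))).
Proof.
elim: i t G => [|j i ih] t G lG /=; first by rewrite /excess muln0 scale1r.
move=> /andP[j1 i1] jit; rewrite -(cat_take_drop j t).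
have jt : (j <= size t)%N by rewrite -jit leq_addr.
set t1 := take j t; set t2 := drop j t.
have st1 : size t1 = j by rewrite size_takel.
have st2 : sumn i = size t2 by rewrite size_drop -jit addKn.
rewrite take_size_cat // drop_size_cat // tw_cat map_cat take_size_cat; last first.
  by rewrite !size_map size_tw.
rewrite drop_size_cat; last by rewrite !size_map size_tw.
set d := sumz _; rewrite -(ih t2 (fun u => G (_ :: u))) //; last exact: wlinear_cons.
have sc : size (cut (fun s => f (tw s)) i t2) = size i.
  by elim: (i) (t2) => //= k i' ih' t'; rewrite ih'.
rewrite ksgnK sc (multimap_ksgn _ fP) ?size_tw ?st1 // !map_ksgnK.
rewrite (@eq_map_ksgn _ _ (e%:Z + (size i)%:Z)); last first.
  rewrite /d sumz_blocks // st2 !(pzD, pzN, pz_nat).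
  by case: odd; case: odd; case: odd.
rewrite (wlinear_scale_at [::]) // !scalerA; congr (_ *: _).
rewrite /excess /= -[LHS]signr_odd -[X in _ = X * _]signr_odd -signr_addb.
congr (_ ^+ nat_of_bool _).
rewrite !(pzD, pzN, pz_nat, oddD, oddM) /= -[in odd j](prednK j1) oddS.
by case: (odd e); case: (odd j.-1); case: (odd (size i));
  case: (odd (dsign i)); case: (odd (sumn _)).
Qed.

Lemma pull_blocks (U : lmodType K) (G : seq B -> U) (e : nat) t : wlinear G ->
  \sum_(i <- decomps (size t)) ((-1) ^+ (dsign i + e * excess i) : K) *:
     G (blocks f i (map (ksgn e%:Z) (tw t))) =
  pull (fun s => f (tw s)) (fun s => G (map (ksgn e%:Z) (tw s))) t.
Proof.
move=> lG; apply: eq_big_seq => i; rewrite mem_decomps => /andP[i1 /eqP it].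
exact: blocks_tw.
Qed.

Lemma module_signE i : all (leq 1) i -> module_sign i = (dsign i + excess i)%N.
Proof.
rewrite /module_sign /excess; elim: i => //= j i ih /andP[j1 /ih ->].
by rewrite size_rcons mulSnr addnACA.
Qed.

End Blocks.

End Shift.

(** * Restriction of scalars *)

Section Restriction.
Variable K : fieldType.
Implicit Types A B M : gspace K.

(** The varying letter lies in exactly one block; the induction discards the blocks before it. *)
Lemma blocks_linear A B (U : lmodType K) (f : seq A -> B) (G : seq B -> U) i
    s1 s2 : wlinear f -> wlinear G -> sumn i = (size s1 + size s2).+1 ->
  linear (fun a => G (blocks f i (s1 ++ a :: s2))).
Proof.
move=> lf; elim: i s1 G => [|j i ih] s1 G lG //= ji.
have [js|js] := leqP j (size s1).
  have e a : take j (s1 ++ a :: s2) = take j s1 by rewrite takel_cat.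
  have e' a : drop j (s1 ++ a :: s2) = drop j s1 ++ a :: s2.
    rewrite drop_cat; case: ltngtP js => // -> _.
    by rewrite subnn drop0 drop_size.
  move=> a x y; rewrite !e !e'.
  apply: (ih _ (fun t => G (_ :: t))); first exact: wlinear_cons.
  by apply: (@addnI j); rewrite ji size_drop addnS addnA subnKC.
have [k jE] : exists k, j = (size s1 + k.+1)%N.
  by exists (j - size s1).-1; rewrite prednK ?subn_gt0 // subnKC // ltnW.
have e a : take j (s1 ++ a :: s2) = s1 ++ a :: take k s2.
  by rewrite jE take_cat ltnNge leq_addr /= addKn.
have e' a : drop j (s1 ++ a :: s2) = drop k s2.
  by rewrite jE drop_cat ltnNge leq_addr /= addKn.
move=> a x y; rewrite !e !e' !map_cat /= ksgn_linear lf.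
exact: (lG [::]).
Qed.

Section ShiftedOperation.
Variables (B M : gspace K) (op : seq B -> M -> M).
Hypothesis op_wlinear : forall x, wlinear (op^~ x).

(* The module entry counts as one more letter, whence the extra ksgn 1. *)
Definition shift_op (Phi : seq B) (x : M) : M := op (map (ksgn 1) (tw Phi)) x.

Lemma shift_op_wlinear x : wlinear (shift_op^~ x).
Proof.
apply: (wlinear_tw (G := fun u => op (map (ksgn 1) u) x)).
by apply: (wlinear_map (G := op^~ x)) => //; exact: ksgn_linear.
Qed.

(** The outer operation is applied to letters passed by the inner one, which is odd after the shift;
    [sgn1] on these letters accounts for both (-1)^a and the Koszul sign. *)
Lemma module_splits t x :
  \sum_(0 <= a < (size t).+1) ((-1) ^+ a : K) *:
    op [seq ksgn (2 - ((size t).+1 - a)%N%:Z) c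
         | c <- take a (map (ksgn 1) (tw t))]
       (op (drop a (map (ksgn 1) (tw t))) x) =
  splits (fun u v => shift_op (map (@sgn1 K B) u) (shift_op v x)) t.
Proof.
apply: eq_big_nat => a /andP[_]; rewrite ltnS => ak.
have sa : size (take a t) = a by rewrite size_takel.
rewrite -{2 3}(cat_take_drop a t) tw_cat map_cat.
have sa' d e : size (map (ksgn d) (map (ksgn e) (tw (take a t)))) = a.
  by rewrite !size_map size_tw sa.
rewrite take_size_cat ?sa' // drop_size_cat ?sa' // /shift_op.
rewrite map_sgn1 tw_opp tw_ksgn map_ksgn_opp (wlinear_opp _ (op_wlinear _)).
rewrite !size_map size_tw sa !map_ksgnK.
congr (_ *: op _ _); rewrite size_drop subSn //.
by rewrite !map_ksgn_even // !(pzD, pzN, pz_nat) /= -addbA addbb.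
Qed.

End ShiftedOperation.

Variables (C : ainf_coalgebra K) (A : ainf_algebra K) (M : gspace K).
Variables (f : seq A -> gdual C) (op : seq (gdual C) -> M -> M).
Let B := gdual C.
Let mA := @alg_mul K A.
Let mB := @dual_mul K C.
Let mAP : multimap (fun k => 2 - k%:Z) mA := @alg_mulP K A.
Hypothesis mB_wlinear : wlinear mB.
Hypothesis fP : pairing f.
Hypothesis op_linear : forall Phi, linear (op Phi).
Hypothesis op_wlinear : forall x, wlinear (op^~ x).

Let F s := f (tw s).

Lemma restrict_linear s : linear (restrict module_sign f op s).
Proof.
by apply: linear_bigsum => i _; apply: linear_scale; exact: op_linear.
Qed.

Lemma restrict_wlinear e x : wlinear (fun s => restrict e f op s x).
Proof.
have [[lf _] _] := fP.
move=> s1 s2 a y z; rewrite /restrict !size_cat /= scaler_sumr -big_split /=.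
apply: eq_big_seq => i; rewrite mem_decomps addnS => /andP[_ /eqP iE].
rewrite (blocks_linear lf (op_wlinear x) iE).
by rewrite scalerDr !scalerA [a * _]mulrC.
Qed.

(** After the shift, restriction of scalars is plain pullback: the extra [excess] in [module_sign]
    is the cost of passing the module entry. *)
Lemma shift_restrict t x :
  shift_op (restrict module_sign f op) t x = pull F (shift_op op ^~ x) t.
Proof.
have [fM _] := fP; rewrite -(pull_blocks fM 1 t (op_wlinear x)).
rewrite /shift_op /restrict size_map size_tw; apply: eq_big_seq => i.
rewrite mem_decomps => /andP[i1 _].
by rewrite module_signE // mul1n.
Qed.

Lemma shift_morphism_sgn1 a s :
  F (map (@sgn1 K A) (a :: s)) = sgn1 (F (a :: s)).
Proof.
have [fM _] := fP; rewrite /F map_sgn1 tw_opp tw_ksgn.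
rewrite (wlinear_opp _ fM.1) /sgn1 (multimap_ksgn _ fM) ?size_tw //.
rewrite size_map size_tw -scaleNr; congr (_ *: _).
rewrite -signr_odd !(pzD, pzN, pz_nat) /=.
by case: odd; rewrite ?expr0 ?expr1 ?opprK.
Qed.

Lemma shift_morphism a s :
  coder (@sgn1 K A) (fun t => mA (tw t)) F (a :: s) =
  pull F (fun t => mB (tw t)) (a :: s).
Proof.
have [fM fE] := fP; rewrite -(coder_winner mAP _ fM.1).
have := fE (tw (a :: s)); rewrite size_tw => -> //.
(* The trivial twist by [ksgn 0] gives the form of [pull_blocks] with no letter to the right. *)
transitivity (pull F (fun t => mB (map (ksgn 0) (tw t))) (a :: s)).
  rewrite -(pull_blocks fM 0 _ mB_wlinear); apply: eq_bigr => i _.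
  by rewrite mul0n addn0 (@map_ksgn_even _ _ 0).
by apply: eq_pull => t; rewrite map_ksgn_even.
Qed.

Hypothesis op_rel : forall Phi x,
  coder (@sgn1 K B) (fun t => mB (tw t)) (shift_op op ^~ x) Phi +
  splits (fun u v => shift_op op (map (@sgn1 K B) u) (shift_op op v x)) Phi = 0.

(** Both terms are pullbacks along [F], the first by [coder_pull] and the second by [pull_splits];
    their sum is the pullback of [op_rel]. *)
Lemma shift_restrict_rel t x :
  coder (@sgn1 K A) (fun s => mA (tw s))
    (shift_op (restrict module_sign f op) ^~ x) t +
  splits (fun u v => shift_op (restrict module_sign f op) (map (@sgn1 K A) u)
    (shift_op (restrict module_sign f op) v x)) t = 0.
Proof.
rewrite (eq_coder _ _ _ (fun s => shift_restrict s x)).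
rewrite (coder_pull _ shift_morphism_sgn1 shift_morphism); last first.
  exact: shift_op_wlinear.
rewrite [X in _ + X](_ : _ = pull F (splits (fun u v =>
    shift_op op (map (@sgn1 K B) u) (shift_op op v x))) t).
  by rewrite -pullD /pull big1 // => i _; exact: op_rel.
rewrite pull_splits; apply: eq_splits => u v _.
rewrite !shift_restrict (pull_map _ _ shift_morphism_sgn1).
apply: eq_pull => t1.
by rewrite -(linear_pull F _ _ (op_linear (map (ksgn 1) (tw (map (@sgn1 K B) t1))))).
Qed.

Lemma restrict_rel s x :
  \sum_(0 <= p < size s) \sum_(1 <= q < (size s - p).+1)
    ((-1) ^+ (p + q * ((size s).+1 - p - q)) : K) *:
      restrict module_sign f op (winner mA p q s) x
  + \sum_(0 <= a < (size s).+1)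
    ((-1) ^+ a : K) *:
      restrict module_sign f op
        [seq ksgn (2 - ((size s).+1 - a)%N%:Z) c | c <- take a s]
        (restrict module_sign f op (drop a s) x)
  = 0.
Proof.
(* Every word is a shifted one, since [tw] and [ksgn 1] are involutive. *)
have -> : s = map (ksgn 1) (tw (tw (map (ksgn 1) s))).
  by rewrite twK map_ksgnK map_ksgn_even.
move: (tw (map _ s)) => t; rewrite size_map size_tw.
rewrite module_splits; last by move=> y; exact: restrict_wlinear.
rewrite -[RHS](shift_restrict_rel t x); congr (_ + _).
by rewrite -(coder_winner1 mAP _ (restrict_wlinear module_sign x)).
Qed.

End Restriction.

(** * Tensors and evaluation *)

Section Tensors.
Variable K : fieldType.

Section TensorInd.
Variables V C : lmodType K.

(** A scalar coefficient can be absorbed into the head of a word, so every tensor is a plain sum of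
    words. *)
Lemma tens_ind (P : tens V C -> Prop) : P 0 ->
  (forall v cs t, P t -> P (pure v cs + t)) -> forall t, P t.
Proof.
move=> P0 PD t; have [y ->] := pi_presmod_surj t.
have piL : linear (\pi_(presmod (@tens_rel K V C)) : _ -> tens V C).
  by move=> a u v; rewrite pi_presmodD pi_presmodZ.
rewrite [y]monalgE (lin_sum _ _ _ piL).
elim: (enum_fset (msupp y)) => [|[v cs] s ih]; first by rewrite big_nil.
rewrite big_cons.
have -> : \pi_(presmod (@tens_rel K V C)) << y@_(v, cs) *g (v, cs) >> =
    pure (y@_(v, cs) *: v) cs :> tens V C; last exact: PD.
rewrite (lin_scale _ _ ((@pure_multilinear K V C).1 cs)).
rewrite /pure -(lin_scale _ _ piL); congr (\pi_ _ _).
by apply/malgP => k; rewrite mcoeffZ !mcoeffU mulr_natr.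
Qed.

Lemma tens_ext (U : lmodType K) (F G : tens V C -> U) : linear F -> linear G ->
  (forall v cs, F (pure v cs) = G (pure v cs)) -> F =1 G.
Proof.
move=> lF lG FG; apply: tens_ind => [|v cs t ih].
  by rewrite !linearP0.
by rewrite !lin_add // FG ih.
Qed.

Lemma tlift_param (X U : lmodType K) (F : X -> V -> seq C -> U) t :
  (forall x, multilinear (F x)) -> (forall v cs, linear (fun x => F x v cs)) ->
  linear (fun x => tlift (F x) t).
Proof.
move=> mF lF a x y; move: t; apply: tens_ind.
  by rewrite !(linearP0 (tlift_linear (mF _))) scaler0 addr0.
move=> v cs t ih.
rewrite !(lin_add _ _ (tlift_linear (mF _))) ih !(tlift_pure _ _ (mF _)) lF.
by rewrite scalerDr addrACA.
Qed.

End TensorInd.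

Implicit Types V W C : gspace K.

Lemma thomog_scale V C n l a (t : tens V C) :
  thomog n l t -> thomog n l (a *: t).
Proof.
elim=> [|v d cs ds t' hv hcs sc dn _ ih]; first by rewrite scaler0; exact: thomog0.
rewrite scalerDr -(lin_scale _ _ ((@pure_multilinear K V C).1 cs)).
by apply: thomogD hcs sc dn ih; exact: homogZ.
Qed.

Lemma thomog_ext V C (U : lmodType K) (F G : tens V C -> U) n l :
  linear F -> linear G ->
  (forall v d cs ds, homog d v -> hseq ds cs -> size cs = l ->
     d + sumz ds = n -> F (pure v cs) = G (pure v cs)) ->
  forall t, thomog n l t -> F t = G t.
Proof.
move=> lF lG FG t; elim=> [|v d cs ds t' hv hcs sc dn _ ih].
  by rewrite !linearP0.
by rewrite !lin_add // ih (FG v d cs ds).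
Qed.

Lemma comod_w_ext (C : ainf_coalgebra K) (P : ainf_comodule C) (U : lmodType K)
    (F G : tens P C -> U) l :
  linear F -> linear G ->
  (forall v d cs ds, homog d v -> hseq ds cs -> size cs = l ->
     F (pure v cs) = G (pure v cs)) ->
  forall x, F (comod_w l x) = G (comod_w l x).
Proof.
move=> lF lG FG; apply: homog_ext.
- by apply: linear_comp => //; exact: comod_linear.
- by apply: linear_comp => //; exact: comod_linear.
move=> n x hx; apply: (thomog_ext (n := n + (2 - l.+1%:Z)) (l := l)) => //.
  by move=> v d cs ds hv hcs sc _; exact: (FG v d cs ds).
exact: comod_degree.
Qed.

(** * Evaluation of functionals and its signs *)

Section Evaluation.
Variable C : gspace K.
Implicit Types (Phi : seq (gdual C)) (cs : seq C).

(** Evaluation stripped of Koszul signs, which are tracked separately through the degrees of the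
    arguments. *)
Fixpoint pairw Phi cs : K :=
  match Phi, cs with
  | [::], [::] => 1
  | phi :: Phi', c :: cs' => (phi : gdual_car C) c * pairw Phi' cs'
  | _, _ => 0
  end.

Lemma gdual_homog e n (phi : gdual C) c :
  homog e phi -> homog n c -> e != - n -> (phi : gdual_car C) c = 0.
Proof.
move=> he hn en; rewrite -he -hn /= gprojK.
rewrite ifF ?(linearP0 (gdual_linear _)) //.
by apply: contraNF en => /eqP <-; rewrite opprK.
Qed.

(** Only the component of [phi] of degree -n sees [c], so the sign attached to [phi] can be read off
    the degree of [c]. *)
Lemma ksgn_pair d n (phi : gdual C) c : homog n c ->
  (ksgn d phi : gdual_car C) c = (-1) ^+ (pz d && pz n) * (phi : gdual_car C) c.
Proof.
move=> hc; move: phi.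
apply: (homog_ext (F := fun phi : gdual C => (ksgn d phi : gdual_car C) c : K^o)
  (G := fun phi : gdual C => (-1) ^+ (pz d && pz n) * (phi : gdual_car C) c : K^o)).
- by move=> a x y; rewrite ksgn_linear.
- move=> a x y /=; set s := _ ^+ _.
  change (s * (a * (x : gdual_car C) c + (y : gdual_car C) c) =
    a * (s * (x : gdual_car C) c) + s * (y : gdual_car C) c).
  by rewrite mulrDr mulrCA.
move=> e phi he; rewrite (ksgn_homog _ he).
have [eE|en] := eqVneq e (- n); first by rewrite eE pzN.
change ((-1) ^+ (pz d && pz e) * (phi : gdual_car C) c =
  (-1) ^+ (pz d && pz n) * (phi : gdual_car C) c).
by rewrite (gdual_homog he hc en) !mulr0.
Qed.

Lemma pairw_ksgn d ds Phi cs : hseq ds cs ->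
  pairw (map (ksgn d) Phi) cs = (-1) ^+ (pz d && pz (sumz ds)) * pairw Phi cs.
Proof.
elim: cs ds Phi => [|c cs ih] [|n ds] [|phi Phi] //=; rewrite ?mulr0 //.
  by rewrite sumz_nil andbF mul1r.
move=> [hc /(ih _ Phi) ->]; rewrite (ksgn_pair _ _ hc) mulrACA -signr_addb.
by rewrite sumz_cons pzD andb_addr.
Qed.

Lemma pairw_size Phi cs : size Phi <> size cs -> pairw Phi cs = 0.
Proof.
elim: Phi cs => [|phi Phi ih] [|c cs] //= sz.
by rewrite ih ?mulr0 // => e; apply: sz; rewrite e.
Qed.

Lemma pairw_cat Phi1 Phi2 cs1 cs2 : size Phi1 = size cs1 ->
  pairw (Phi1 ++ Phi2) (cs1 ++ cs2) = pairw Phi1 cs1 * pairw Phi2 cs2.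
Proof.
elim: Phi1 cs1 => [|phi Phi1 ih] [|c cs1] //= ; first by rewrite mul1r.
by move=> [/ih ->]; rewrite mulrA.
Qed.

Lemma pairw_homog es Phi ds cs : hseq es Phi -> hseq ds cs ->
  sumz es != - sumz ds -> pairw Phi cs = 0.
Proof.
elim: cs es ds Phi => [|c cs ih] [|e es] [|d ds] [|phi Phi] //=.
  by rewrite sumz_nil oppr0 eqxx.
move=> [he hes] [hd hds]; rewrite !sumz_cons opprD => ne.
have [ed|ed] := eqVneq e (- d); last by rewrite (gdual_homog he hd) ?mul0r.
by rewrite (ih es ds) ?mulr0 //; apply: contraNneq ne => ->; rewrite ed.
Qed.

Lemma pairw_linear Phi1 Phi2 cs :
  linear (fun phi => pairw (Phi1 ++ phi :: Phi2) cs : K^o).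
Proof.
elim: Phi1 cs => [|phi Phi1 ih] [|c cs] a x y /=; rewrite ?scaler0 ?addr0 //.
  change ((a * (x : gdual_car C) c + (y : gdual_car C) c) * pairw Phi2 cs =
    a * ((x : gdual_car C) c * pairw Phi2 cs) + (y : gdual_car C) c * pairw Phi2 cs).
  by rewrite mulrDl mulrA.
by rewrite ih mulrDr; congr (_ + _); exact: mulrCA.
Qed.

(** The parity of the sum of |c_i||c_j| over i < j, each functional phi_j being moved past the
    earlier c_i. *)
Fixpoint crossings (ds : seq int) : bool :=
  if ds is d :: ds' then (pz d && pz (sumz ds')) (+) crossings ds' else false.

Lemma kpairE ds Phi cs : hseq ds cs ->
  kpair Phi cs = (-1) ^+ crossings ds * pairw Phi cs.
Proof.
elim: cs ds Phi => [|c cs ih] [|d ds] [|phi Phi] //=; rewrite ?mulr0 ?mulr1 //.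
move=> [hc hcs]; rewrite (hsum_homog _ hc); last first.
  by move=> n; rewrite (linearP0 (gdual_linear phi)) mul0r.
rewrite (ih ds) // (pairw_ksgn _ _ hcs) mulrCA [X in _ * X]mulrCA.
by rewrite mulrA -signr_addb addbC.
Qed.

Lemma kpair_wlinear cs : wlinear (fun Phi => kpair Phi cs).
Proof.
move=> Phi1 Phi2 a x y.
apply: (wlinear_ext (G := fun cs => kpair (Phi1 ++ (a *: x + y) :: Phi2) cs)
  (H := fun cs => a *: kpair (Phi1 ++ x :: Phi2) cs +
    kpair (Phi1 ++ y :: Phi2) cs) (n := size cs)) => //.
- by move=> s1 s2; exact: kpair_linear.
- move=> s1 s2 b u v; rewrite !kpair_linear !scalerDr !scalerA mulrC.
  by rewrite addrACA.
move=> ds s _ hs; rewrite !(kpairE _ hs) pairw_linear mulrDr.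
by congr (_ + _); exact: mulrCA.
Qed.

Lemma teval_linear (V : gspace K) Phi : linear (@teval K C V Phi).
Proof. exact: tlift_linear (kact_multilinear _ _). Qed.

Lemma teval_wlinear (V : gspace K) (t : tens V C) :
  wlinear (fun Phi => teval Phi t).
Proof.
move=> Phi1 Phi2; apply: tlift_param => [phi|v cs a x y].
  exact: kact_multilinear.
move: v; apply: homog_ext.
- exact: ((kact_multilinear _ _).1 cs).
- move=> b u v; rewrite !(kact_multilinear _ _).1 !scalerDr !scalerA mulrC.
  by rewrite addrACA.
move=> n v hv; rewrite /kact !(hsum_homog _ hv);
  try by move=> m; rewrite scaler0.
rewrite (wlinear_map (@ksgn_linear _ _ n) (kpair_wlinear cs)).
by rewrite scalerDl scalerA.
Qed.

Lemma teval_pure (V : gspace K) Phi n (v : V) ds cs : homog n v -> hseq ds cs ->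
  teval Phi (pure v cs) =
  ((-1) ^+ (crossings ds (+) pz n && pz (sumz ds)) * pairw Phi cs) *: v.
Proof.
move=> hv hcs; rewrite /teval (tlift_pure _ _ (kact_multilinear _ _)) /kact.
rewrite (hsum_homog _ hv); last by move=> m; rewrite scaler0.
by rewrite (kpairE _ hcs) (pairw_ksgn _ _ hcs) mulrA -signr_addb.
Qed.

Lemma tcoeval_multilinear (V : gspace K) Phi :
  multilinear (fun (v : V) cs => kpair [seq ksgn 1 psi | psi <- Phi] cs *: v).
Proof.
split=> [cs a x y|v s1 s2 a x y]; first by rewrite scalerDr !scalerA mulrC.
by rewrite kpair_linear scalerDl scalerA.
Qed.

Lemma tcoeval_linear (V : gspace K) Phi : linear (fun t : tens V C => tcoeval t Phi).
Proof. exact: tlift_linear (tcoeval_multilinear _ _). Qed.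

Lemma tcoeval_wlinear (V : gspace K) (t : tens V C) : wlinear (tcoeval t).
Proof.
move=> Phi1 Phi2; apply: tlift_param => [phi|v cs a x y].
  exact: tcoeval_multilinear.
rewrite (wlinear_map (@ksgn_linear _ _ 1) (kpair_wlinear cs)).
by rewrite scalerDl scalerA.
Qed.

Lemma tcoeval_pure (V : gspace K) Phi (v : V) ds cs : hseq ds cs ->
  tcoeval (pure v cs) Phi =
  ((-1) ^+ (crossings ds (+) pz (sumz ds)) * pairw Phi cs) *: v.
Proof.
move=> hcs; rewrite /tcoeval (tlift_pure _ _ (tcoeval_multilinear _ _)).
by rewrite (kpairE _ hcs) (pairw_ksgn _ _ hcs) mulrA -signr_addb.
Qed.

Fixpoint twist (ds : seq int) : bool :=
  if ds is d :: ds' then (odd (size ds') && pz d) (+) twist ds' else false.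

Lemma pairw_tw ds Phi cs : hseq ds cs ->
  pairw (tw Phi) cs = (-1) ^+ twist ds * pairw Phi cs.
Proof.
elim: cs ds Phi => [|c cs ih] [|d ds] [|phi Phi] //=; rewrite ?mulr0 ?mulr1 //.
move=> [hc hcs]; rewrite (ih _ _ hcs).
have [sz|sz] := eqVneq (size Phi) (size cs); last first.
  by rewrite pairw_size ?mulr0 //; exact/eqP.
rewrite (ksgn_pair _ _ hc) mulrACA -signr_addb pz_nat sz.
by rewrite (hseq_size hcs).
Qed.

(* The sign of phi_1(c_1) ... phi_l(c_l) v in the shifted evaluation of
   phi_1 (x) ... (x) phi_l on v (x) c_1 (x) ... (x) c_l, for n = |v|: phi_i, of
   degree -|c_i|, contributes |c_i| (n + 1 + sum_(j < i) (|c_j| + 1)). *)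
Fixpoint esgn (n : bool) (ds : seq int) : bool :=
  if ds is d :: ds' then (pz d && ~~ n) (+) esgn (~~ (n (+) pz d)) ds'
  else false.

(** The parity of the total degree after the shift, a letter c counting for |c| + 1 modulo 2. *)
Definition sdeg (ds : seq int) : bool := pz (sumz ds) (+) odd (size ds).

(** The closed form collects the signs produced by [teval], [tw] and the twist by length; the
    recursive form is the one that splits along concatenation. *)
Lemma esgnE n ds : esgn n ds = (crossings ds (+) twist ds)
  (+) ((n && pz (sumz ds)) (+) (odd (size ds) && pz (sumz ds))).
Proof.
elim: ds n => [|d ds ih] n /=; first by rewrite sumz_nil /= andbF.
rewrite ih sumz_cons pzD /=.
by case: n; case: pz; case: pz; case: odd; case: crossings; case: twist.
Qed.

Lemma esgn_shift n ds : esgn n ds = (n && pz (sumz ds)) (+) esgn false ds.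
Proof.
by rewrite !esgnE /=; case: n; case: pz; case: crossings; case: twist; case: odd.
Qed.

Lemma esgn_cat n ds1 ds2 :
  esgn n (ds1 ++ ds2) = esgn n ds1 (+) esgn (n (+) sdeg ds1) ds2.
Proof.
elim: ds1 n => [|d ds1 ih] n /=; first by rewrite /sdeg sumz_nil addbF.
rewrite ih -addbA; congr (_ (+) (_ (+) esgn _ _)).
by rewrite /sdeg sumz_cons pzD /=; case: n; case: pz; case: pz; case: odd.
Qed.

Lemma pairw_sgn1 ds Phi cs : hseq ds cs ->
  pairw (map (@sgn1 K (gdual C)) Phi) cs = (-1) ^+ sdeg ds * pairw Phi cs.
Proof.
move=> hcs; rewrite map_sgn1 /sdeg.
have [sz|sz] := eqVneq (size Phi) (size cs); last first.
  by rewrite !pairw_size ?mulr0 ?size_map //; exact/eqP.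
have lp : wlinear (fun Phi => pairw Phi cs : K^o).
  by move=> Phi1 Phi2; exact: pairw_linear.
have -> : pairw (map -%R (map (ksgn 1) Phi)) cs =
    (-1) ^+ size cs * pairw (map (ksgn 1) Phi) cs.
  by have := wlinear_opp (map (ksgn 1) Phi) lp; rewrite size_map sz.
rewrite (pairw_ksgn _ _ hcs) -(hseq_size hcs).
by rewrite -signr_odd mulrA -signr_addb addbC.
Qed.

End Evaluation.

Section ShiftedEvaluation.
Variable C : gspace K.
Implicit Types (Phi : seq (gdual C)) (cs : seq C).

(** Evaluation after the shift. For a comodule, the twist by [size Phi] combines, modulo 2, the
    extra [ksgn 1] for the module entry with the degree 1 - l of w_{l+1}. *)
Definition tev V Phi (t : tens V C) : V :=
  teval [seq ksgn (size Phi)%:Z phi | phi <- tw Phi] t.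

Lemma tev_linear V Phi : linear (@tev V Phi).
Proof. exact: teval_linear. Qed.

Lemma tev_pure V Phi n (v : V) ds cs : homog n v -> hseq ds cs ->
  tev Phi (pure v cs) = ((-1) ^+ esgn (pz n) ds * pairw Phi cs) *: v.
Proof.
move=> hv hcs; rewrite /tev (teval_pure _ hv hcs).
have [sz|sz] := eqVneq (size Phi) (size cs); last first.
  by rewrite !pairw_size ?mulr0 ?size_map ?size_tw //; exact/eqP.
rewrite (pairw_ksgn _ _ hcs) (pairw_tw _ hcs) !mulrA -!signr_addb esgnE sz.
rewrite pz_nat (hseq_size hcs); congr (((-1) ^+ nat_of_bool _ * _) *: _).
by case: crossings; case: twist; case: pz; case: pz; case: odd.
Qed.

End ShiftedEvaluation.

End Tensors.

(** * Evaluation of the terms of the comodule relation *)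

Section TensorOperations.
Variable K : fieldType.
Implicit Types V W C : gspace K.

Lemma pure_wlinear V C (v : V) : wlinear (fun cs : seq C => pure v cs).
Proof. exact: (pure_multilinear _ _).2. Qed.

Lemma tplug_multilinear V C (v : V) (s1 s2 : seq C) :
  multilinear (fun (a : gunit K) s => @pure K V C ((a : K) *: v) (s1 ++ s ++ s2)).
Proof.
split=> [s a x y|x t1 t2].
  by rewrite scalerDl -scalerA (pure_multilinear _ _).1.
by move=> b y z; rewrite -!catA !(catA s1 t1) (pure_multilinear _ _).2.
Qed.

Lemma tplug_linear V C (v : V) (s1 s2 : seq C) : linear (tplug v s1 s2).
Proof. exact: tlift_linear (tplug_multilinear v s1 s2). Qed.

Lemma tplug_pure V C (v : V) (s1 s2 : seq C) (a : gunit K) s :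
  tplug v s1 s2 (pure a s) = @pure K V C ((a : K) *: v) (s1 ++ s ++ s2).
Proof. exact: tlift_pure (tplug_multilinear _ _ _). Qed.

Lemma tplug_linear_head V C (s1 s2 : seq C) t :
  linear (fun v : V => tplug v s1 s2 t).
Proof.
apply: tlift_param => [v|a s b x y]; first exact: tplug_multilinear.
by rewrite scalerDr scalerA mulrC -scalerA (pure_multilinear _ _).1.
Qed.

Lemma tplug_wlinear_left V C (v : V) (s2 : seq C) t :
  wlinear (fun s1 => tplug v s1 s2 t).
Proof.
move=> X Y; apply: tlift_param => [c|a s b x y]; first exact: tplug_multilinear.
by rewrite -!catA; exact: pure_wlinear.
Qed.

Lemma tplug_wlinear_right V C (v : V) (s1 : seq C) t :
  wlinear (fun s2 => tplug v s1 s2 t).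
Proof.
move=> X Y; apply: tlift_param => [c|a s b x y]; first exact: tplug_multilinear.
by rewrite !(catA s) !(catA s1); exact: pure_wlinear.
Qed.

Lemma tinner_multilinear V C d p (w : C -> tens (gunit K) C) : linear w ->
  multilinear (fun (v : V) cs => tplug (ksgn d v)
    [seq ksgn d c | c <- take p cs] (drop p.+1 cs) (w (nth 0 cs p))).
Proof.
move=> lw; split=> [cs|v s1 s2].
  by move=> a x y; rewrite ksgn_linear; exact: tplug_linear_head.
(* Three cases: the varying letter is to the right of position [p], at it, or to its left. *)
have [ps|ps] := leqP (size s1) p; last first.
  have e c : [/\ take p (s1 ++ c :: s2) = take p s1,
      drop p.+1 (s1 ++ c :: s2) = drop p.+1 s1 ++ c :: s2 &
      nth 0 (s1 ++ c :: s2) p = nth 0 s1 p].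
    split; first by rewrite takel_cat // ltnW.
      rewrite drop_cat; case: (ltngtP p.+1 (size s1)) ps => // -> _.
      by rewrite subnn drop0 drop_size.
    by rewrite nth_cat ps.
  move=> a x y; have [-> -> ->] := e (a *: x + y); have [-> -> ->] := e x.
  by have [-> -> ->] := e y; exact: tplug_wlinear_right.
case: ltngtP ps => // [ps|<-] _; last first.
  move=> a x y; rewrite !take_size_cat // !nth_cat ltnn subnn /=.
  by rewrite -!cat_rcons !drop_size_cat ?size_rcons // lw tplug_linear.
have [k ->] : exists k, p = (size s1 + k.+1)%N.
  by exists (p - size s1).-1; rewrite prednK ?subn_gt0 // subnKC // ltnW.
have e c : [/\ take (size s1 + k.+1) (s1 ++ c :: s2) = s1 ++ c :: take k s2,
    drop (size s1 + k.+1).+1 (s1 ++ c :: s2) = drop k.+1 s2 &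
    nth 0 (s1 ++ c :: s2) (size s1 + k.+1) = nth 0 s2 k].
  split; first by rewrite take_cat ltnNge leq_addr /= addKn.
    by rewrite -addnS drop_cat ltnNge leq_addr /= addKn.
  by rewrite nth_cat ltnNge leq_addr /= addKn.
move=> a x y; have [-> -> ->] := e (a *: x + y); have [-> -> ->] := e x.
have [-> -> ->] := e y; rewrite !map_cat /= ksgn_linear.
exact: tplug_wlinear_left.
Qed.

Lemma tinner_linear V C d p (w : C -> tens (gunit K) C) : linear w ->
  linear (@tinner K V C d p w).
Proof. by move=> lw; exact: tlift_linear (tinner_multilinear _ _ _ lw). Qed.

Lemma touter_pure_multilinear V C (cs : seq C) :
  multilinear (fun (v : V) s => pure v (s ++ cs)).
Proof.
split=> [s|v s1 s2]; first exact: (pure_multilinear _ _).1.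
by move=> a x y; rewrite -!catA; exact: pure_wlinear.
Qed.

Lemma touter_multilinear V C (w : V -> tens V C) : linear w ->
  multilinear (fun v cs => tlift (fun v' s => pure v' (s ++ cs)) (w v)).
Proof.
move=> lw; split=> [cs|v s1 s2].
  by apply: linear_comp => //; exact: tlift_linear (touter_pure_multilinear _ _).
apply: tlift_param => [c|v' s a x y]; first exact: touter_pure_multilinear.
by rewrite !(catA s s1); exact: pure_wlinear.
Qed.

Lemma touter_linear V C (w : V -> tens V C) : linear w -> linear (touter w).
Proof. by move=> lw; exact: tlift_linear (touter_multilinear lw). Qed.

(** Inserting [w c] for [c] and evaluating is dual to replacing [Phi2] by [psi], its product in the
    dual algebra. *)
Lemma tev_tinner V (C : gspace K) q (w : C -> tens (gunit K) C)
    Phi1 Phi2 Phi3 (psi : gdual C) n (v : V) ds cs :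
  linear w ->
  (forall m c, homog m c -> thomog (m + (2 - q%:Z)) q (w c)) ->
  (forall c, (psi : gdual_car C) c = (-1) ^+ q * (tev Phi2 (w c) : K)) ->
  size Phi2 = q -> homog n v -> hseq ds cs ->
  size cs = (size Phi1 + 1 + size Phi3)%N ->
  (-1) ^+ ((size Phi1).+1 * q + size Phi3) *:
    tev (map (@sgn1 K (gdual C)) (Phi1 ++ Phi2 ++ Phi3))
      (tinner (2 - q%:Z) (size Phi1) w (pure v cs)) =
  tev (map (@sgn1 K (gdual C)) Phi1 ++ psi :: Phi3) (pure v cs).
Proof.
move=> lw wdeg psiE sPhi2 hv hcs scs.
have [cs1 [c [cs2 [csE s1 s2]]]] : exists cs1 c cs2,
    [/\ cs = cs1 ++ c :: cs2, size cs1 = size Phi1 & size cs2 = size Phi3].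
  exists (take (size Phi1) cs), (nth 0 cs (size Phi1)), (drop (size Phi1).+1 cs).
  have lt : (size Phi1 < size cs)%N by rewrite scs addn1 leq_addr.
  split; first by rewrite -drop_nth // cat_take_drop.
    by rewrite size_takel // ltnW.
  by rewrite size_drop scs addn1 addKn.
move: hcs; rewrite csE => /hseq_catP [ds1 [[|d ds2] [_ h1]]] //= [hc h2].
rewrite (tev_pure _ hv (hseq_cat h1 (conj hc h2 : hseq (d :: ds2) (c :: cs2)))).
rewrite pairw_cat ?size_map //= psiE (pairw_sgn1 _ h1).
rewrite /tinner (tlift_pure _ _ (tinner_multilinear _ _ _ lw)).
rewrite -s1 take_size_cat // nth_cat ltnn subnn /= -cat_rcons.
rewrite drop_size_cat ?size_rcons // (ksgn_homog _ hv).
rewrite (lin_scale _ _ (@tplug_linear_head _ _ _ _ _)).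
rewrite (wlinear_ksgn _ (@tplug_wlinear_left _ _ _ _ _) h1) scalerA -signr_addb.
move: (wdeg _ _ hc); move: (w c) => t.
set S := _ ^+ nat_of_bool _; set E := _ ^+ nat_of_bool _.
set D := _ ^+ nat_of_bool _.
(* The factor depending on [t] is isolated: both sides are then linear in [t] and can be compared on
   homogeneous words. *)
rewrite (_ : E * _ = E * (D * pairw Phi1 cs1 * ((-1) ^+ q * pairw Phi3 cs2)) *
  (tev Phi2 t : K)); last by rewrite !mulrA [in RHS]mulrAC.
rewrite -scalerA; move: t; apply: thomog_ext.
- apply: linear_scale; apply: linear_comp; first exact: tev_linear.
  by apply: linear_scale; exact: tplug_linear.
- apply: linear_scale.
  apply: (linear_comp (F := fun k : (K^o : lmodType K) => k *: v)).
    exact: linear_scalel.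
  exact: tev_linear.
move=> a e us eus ha hus sus esum.
rewrite tplug_pure (tev_pure _ ha hus).
rewrite (lin_scale _ _ (@tev_linear _ _ _ _)).
rewrite (tev_pure _ (homogZ _ hv) (hseq_cat h1 (hseq_cat hus h2))).
rewrite (pairw_sgn1 _ (hseq_cat h1 (hseq_cat hus h2))) !pairw_cat ?sPhi2 //.
have sA (x : K) : ((x *: a : gunit K) : K) *: v = x *: ((a : K) *: v).
  by rewrite scalerA.
(* The head of a word in [w c] is a scalar, and homogeneous scalars of nonzero degree vanish. *)
rewrite sA {sA}; have [e0|e0] := eqVneq e 0; last first.
  have -> : a = 0 by move: ha; rewrite /homog /= (negbTE e0).
  by rewrite scale0r !scaler0.
move: (_ *: v : V) => av; rewrite !scalerA; congr (_ *: _).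
rewrite [LHS](_ : _ = ((-1) ^+ ((size cs1).+1 * q + size Phi3) * S *
    (-1) ^+ esgn (pz n) (ds1 ++ eus ++ ds2) * (-1) ^+ sdeg (ds1 ++ eus ++ ds2)) *
  (pairw Phi1 cs1 * (pairw Phi2 us * pairw Phi3 cs2))); last by rewrite !mulrA.
rewrite [RHS](_ : _ = (E * D * (-1) ^+ q * (-1) ^+ esgn (pz e) eus) *
  (pairw Phi1 cs1 * (pairw Phi2 us * pairw Phi3 cs2))); last first.
  by ring.
congr (_ * _); rewrite /E /D /S.
rewrite -[(-1) ^+ (_ + _)%N]signr_odd -[(-1) ^+ q]signr_odd -!signr_addb.
congr (_ ^+ nat_of_bool _).
have pe : pz (sumz eus) = pz d (+) odd q.
  by have := congr1 pz esum; rewrite e0 add0r !(pzD, pzN, pz_nat).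
rewrite !esgn_cat /= !(esgn_shift (_ (+) _)) !(esgn_shift (~~ _)) e0.
rewrite /sdeg !sumz_cat !size_cat !(pzD, oddD, oddM) pe.
rewrite (hseq_size hus) sus (hseq_size h1) (hseq_size h2) s1 s2.
rewrite pzN pz_nat oddS (_ : pz 0 = false) //.
case: (odd q); case: (pz d); case: (pz n); case: (pz (sumz ds1));
  case: (odd (size Phi1)); case: (odd (size Phi3)); case: (pz (sumz ds2));
  by case: (esgn _ ds1); case: (esgn _ ds2); case: (esgn _ eus).
Qed.

(** Evaluating [Phi2] on [cs] leaves a multiple of [v], so it may be done before or after applying
    the coaction to [v]; the degree of the coaction fixes the parity of the new head. *)
Lemma tev_touter (C : ainf_coalgebra K) (P : ainf_comodule C) Phi1 Phi2
    n (v : P) ds (cs : seq C) :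
  homog n v -> hseq ds cs -> size cs = size Phi2 ->
  (-1) ^+ size Phi2 *:
    tev (map (@sgn1 K (gdual C)) (Phi1 ++ Phi2))
      (touter (comod_w (size Phi1)) (pure v cs)) =
  tev (map (@sgn1 K (gdual C)) Phi1)
    (comod_w (size Phi1) (tev Phi2 (pure v cs))).
Proof.
move=> hv hcs scs; rewrite (tev_pure _ hv hcs).
rewrite (lin_scale _ _ (@comod_linear _ _ P _)).
rewrite (lin_scale _ _ (@tev_linear _ _ _ _)).
rewrite /touter (tlift_pure _ _ (touter_multilinear (@comod_linear _ _ P _))).
move: (comod_degree (size Phi1) hv); move: (comod_w _ v).
have lt := tlift_linear (touter_pure_multilinear P cs).
apply: thomog_ext.
- by apply: linear_scale; apply: linear_comp; first exact: tev_linear.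
- by apply: linear_scale; exact: tev_linear.
move=> v' m s es hv' hs ss msum.
rewrite (tlift_pure _ _ (touter_pure_multilinear _ _)).
rewrite (tev_pure _ hv' (hseq_cat hs hcs)) (tev_pure _ hv' hs) !scalerA.
congr (_ *: _); rewrite map_cat pairw_cat ?size_map // (pairw_sgn1 _ hs).
rewrite (pairw_sgn1 _ hcs).
rewrite [LHS](_ : _ = ((-1) ^+ size Phi2 * (-1) ^+ esgn (pz m) (es ++ ds) *
   (-1) ^+ sdeg es * (-1) ^+ sdeg ds) * (pairw Phi1 s * pairw Phi2 cs));
  last by ring.
rewrite [RHS](_ : _ = ((-1) ^+ esgn (pz n) ds * (-1) ^+ esgn (pz m) es *
   (-1) ^+ sdeg es) * (pairw Phi1 s * pairw Phi2 cs));
  last by ring.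
congr (_ * _); rewrite -[(-1) ^+ size Phi2]signr_odd -!signr_addb.
congr (_ ^+ nat_of_bool _).
have pm : pz m = pz (sumz es) (+) pz n (+) ~~ odd (size Phi1).
  have := congr1 pz msum; rewrite !(pzD, pzN, pz_nat) /=.
  by case: pz; case: pz; case: pz; case: odd.
rewrite esgn_cat (esgn_shift (_ (+) _)) (esgn_shift (pz n)) /sdeg pm.
rewrite (hseq_size hs) ss (hseq_size hcs) scs.
case: (odd (size Phi1)); case: (odd (size Phi2)); case: (pz n);
  case: (pz (sumz es)); case: (pz (sumz ds));
  by case: (esgn _ es); case: (esgn _ ds).
Qed.


End TensorOperations.

(** * The dual module of a comodule *)

Section DualModule.
Variables (K : fieldType) (C : ainf_coalgebra K).
Implicit Type Phi : seq (gdual C).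

Lemma dual_mul_wlinear : wlinear (@dual_mul K C).
Proof.
move=> s1 s2 a x y; apply: gdual_ext => c.
rewrite /= /dual_mul_fun !size_cat /=; set k := (size s1 + _)%N.
have h := wlinear_map (@ksgn_linear _ _ k%:Z)
  (teval_wlinear (V := gunit K) (coalg_w k c)).
rewrite h; set u := teval _ _; set v := teval _ _.
by rewrite scalerDr !scalerA mulrC.
Qed.

Lemma dual_mul_tw Phi c : (dual_mul (tw Phi) : gdual_car C) c =
  (-1) ^+ size Phi * (tev Phi (coalg_w (size Phi) c) : K).
Proof. by rewrite /= /dual_mul_fun size_tw. Qed.

Variable P : ainf_comodule C.

Lemma dual_op_linear Phi : linear (@dual_op K C P Phi).
Proof. exact: linear_comp (@teval_linear _ _ _ _) (@comod_linear _ _ P _). Qed.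

Lemma dual_op_wlinear x : wlinear (fun Phi => @dual_op K C P Phi x).
Proof.
move=> s1 s2; rewrite /dual_op => a y z; rewrite !size_cat /=.
exact: (wlinear_map (@ksgn_linear _ _ _) (teval_wlinear _)).
Qed.

Lemma shift_dual_op Phi x :
  shift_op (@dual_op K C P) Phi x = tev Phi (comod_w (size Phi) x).
Proof.
rewrite /shift_op /dual_op /tev size_map size_tw map_ksgnK.
congr (teval _ _); apply: eq_map_ksgn.
by rewrite !(pzD, pzN, pz_nat) /=; case: odd.
Qed.

(* The image of the relation of P under the shifted evaluation. *)
Lemma dual_op_rel Phi x :
  coder (@sgn1 K (gdual C)) (fun s => dual_mul (tw s))
    (shift_op (@dual_op K C P) ^~ x) Phi +
  splits (fun u v => shift_op (@dual_op K C P) (map (@sgn1 K (gdual C)) u)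
    (shift_op (@dual_op K C P) v x)) Phi = 0.
Proof.
(* An opaque name for the evaluation. The letters carry [sgn1] because [tev_tinner] and [tev_touter]
   then leave it only on letters to the left of the operator. *)
have [L lL LE] : exists2 L : tens P C -> P, linear L &
    L = tev (map (@sgn1 K (gdual C)) Phi).
  by exists (tev (map (@sgn1 K (gdual C)) Phi)) => //; exact: tev_linear.
have := congr1 L (comod_rel x (ltn0Sn (size Phi))).
rewrite (linearP0 lL).
rewrite (lin_add _ _ lL).
rewrite [X in X + _](lin_sum _ _ _ lL) [X in _ + X](lin_sum _ _ _ lL).
(* In the comodule relation the head in [P] counts as an entry, so the indices start at 1; shifted
   down, they are positions in [Phi]. *)
rewrite !big_add1.
rewrite /=.
move=> h; rewrite -[RHS]h; congr (_ + _).
  apply: eq_big_nat => p /andP[_ pk].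
  rewrite (lin_sum _ _ _ lL) subSS; apply: eq_big_nat => q /andP[q0].
  rewrite ltnS => qk; rewrite (lin_scale _ _ lL) shift_dual_op.
  set Phi1 := take p Phi; pose Phi2 : seq (gdual C) := take q (drop p Phi).
  set Phi3 := drop (p + q) Phi; rewrite -[take q _]/Phi2.
  have s1 : size Phi1 = p by rewrite size_takel // ltnW.
  have s2 : size Phi2 = q by rewrite size_takel // size_drop.
  have s3 : size Phi3 = (size Phi - p - q)%N by rewrite size_drop subnDA.
  have PhiE : Phi = Phi1 ++ Phi2 ++ Phi3.
    by rewrite /Phi3 addnC -drop_drop !cat_take_drop.
  rewrite size_cat size_map /= s1 -s3 -[in LHS]addSnnS /=.
  apply: (comod_w_ext (F := fun t => tev _ t)
    (G := fun t => _ *: L (tinner _ _ _ t))).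
  - exact: tev_linear.
  - apply: linear_scale; apply: linear_comp => //.
    by apply: tinner_linear; exact: coalg_linear.
  move=> v d cs ds hv hcs scs; rewrite LE {1}PhiE -s1.
  rewrite (tev_tinner (w := @coalg_w K C q) (psi := dual_mul (tw Phi2))
    _ _ _ s2 hv hcs) //.
  - exact: coalg_linear.
  - by move=> m c; exact: coalg_degree.
  - by move=> c; rewrite dual_mul_tw s2.
  - by rewrite s1 addn1.
apply: eq_big_nat => a /andP[_]; rewrite ltnS => ak.
rewrite subSS (lin_scale _ _ lL) !shift_dual_op size_map.
have s1 : size (take a Phi) = a by rewrite size_takel.
rewrite -size_drop.
apply: (comod_w_ext (F := fun t => tev _ (comod_w _ (tev _ t)))
    (G := fun t => _ *: L (touter _ t))).
- apply: (linear_comp (F := fun y => tev _ (comod_w _ y))); last exact: tev_linear.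
  by apply: linear_comp; [exact: tev_linear | exact: comod_linear].
- apply: linear_scale; apply: linear_comp => //.
  by apply: touter_linear; exact: comod_linear.
move=> v d cs ds hv hcs scs.
have := tev_touter (take a Phi) hv hcs scs.
by rewrite cat_take_drop s1 LE.
Qed.

Lemma teval_homog N l (t : tens P C) es Phi :
  thomog N l t -> hseq es Phi -> homog (N + sumz es) (teval Phi t).
Proof.
move=> ht hP; elim: ht => [|v d cs ds t' hv hcs _ dN _ ih].
  by rewrite (linearP0 (@teval_linear _ _ _ _)); exact: homog0.
rewrite (lin_add _ _ (@teval_linear _ _ _ _)); apply: homogD ih.
rewrite (teval_pure _ hv hcs).
have [e|e] := eqVneq (sumz es) (- sumz ds).
  by rewrite e -dN addrK; exact: homogZ.
by rewrite (pairw_homog hP hcs e) mulr0 scale0r; exact: homog0.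
Qed.

Lemma dual_op_homog es Phi d (x : P) : hseq es Phi -> homog d x ->
  homog (sumz es + d + (2 - (size Phi).+1%:Z)) (dual_op Phi x).
Proof.
move=> hP hx; rewrite -addrA addrC; apply: (@teval_homog _ (size Phi)).
  exact: comod_degree.
by apply: hseq_map hP => n v; exact: homog_ksgn.
Qed.

End DualModule.

Lemma size_blocks (K : fieldType) (A B : gspace K) (f : seq A -> B) i s :
  size (blocks f i s) = size i.
Proof. by elim: i s => //= j i ih s; rewrite ih. Qed.

Lemma hseq_blocks (K : fieldType) (A B : gspace K) (f : seq A -> B) i ds s :
  multimap (fun k => 1 - k%:Z) f -> all (leq 1) i -> sumn i = size s ->
  hseq ds s ->
  exists2 es, hseq es (blocks f i s) &
    sumz es = sumz ds + (size i)%:Z - (size s)%:Z.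
Proof.
move=> [_ fdeg]; elim: i ds s => [|j i ih] ds s /=.
  move=> _ /esym/size0nil ->; case: ds => // _; exists [::] => //.
  by rewrite !sumz_nil.
move=> /andP[j1 i1] jit hs.
have js : (j <= size s)%N by rewrite -jit leq_addr.
have s1 : size (take j s) = j by rewrite size_takel.
have s2 : sumn i = size (drop j s) by rewrite size_drop -jit addKn.
move: hs; rewrite -{1}(cat_take_drop j s) => /hseq_catP[ds1 [ds2 [-> h1 h2]]].
have [es hes esE] := ih _ _ i1 s2 h2.
exists ((sumz ds1 + (1 - j%:Z)) :: es).
  split=> //; set w := map _ _; have sw : size w = j by rewrite size_map.
  rewrite -[in X in homog (_ + (1 - X%:Z))]sw; apply: fdeg; first by rewrite sw.
  by apply: hseq_map h1 => n v; exact: homog_ksgn.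
rewrite sumz_cons esE sumz_cat -s2 -jit PoszD -addn1 PoszD; ring.
Qed.

Lemma iota_module (K : fieldType) (C : ainf_coalgebra K) (A : ainf_algebra K)
    (f : seq A -> gdual C) (P : ainf_comodule C) :
  pairing f -> is_ainf_module (iotaCA f P).
Proof.
move=> fP; split.
- by move=> s; apply: restrict_linear; exact: dual_op_linear.
- move=> s1 s2 x; apply: restrict_wlinear => //.
  exact: dual_op_wlinear.
- move=> ds s d x hs hx; rewrite /= /restrict big_seq.
  apply: homog_sum => i; rewrite mem_decomps => /andP[i1 /eqP si]; apply: homogZ.
  have [es hes esE] := hseq_blocks fP.1 i1 si hs.
  have := dual_op_homog hes hx; rewrite esE size_blocks.
  have -> : sumz ds + (size i)%:Z - (size s)%:Z + d + (2 - (size i).+1%:Z) =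
      sumz ds + d + (2 - (size s).+1%:Z) by
    rewrite -[(size i).+1]addn1 -[(size s).+1]addn1 !PoszD; ring.
  by [].
move=> s x; apply: restrict_rel => //.
- exact: dual_mul_wlinear.
- exact: dual_op_linear.
- exact: dual_op_wlinear.
- exact: dual_op_rel.
Qed.

(** * Rational pairings *)

Section Naturality.
Variables (K : fieldType) (C V W : gspace K) (h : V -> W).
Hypothesis lh : linear h.

Lemma tmap_multilinear : multilinear (fun v (cs : seq C) => pure (h v) cs).
Proof.
split=> [cs a x y|v s1 s2]; first by rewrite lh (pure_multilinear _ _).1.
exact: pure_wlinear.
Qed.

Lemma tmap_linear : linear (@tmap K V W C h).
Proof. exact: tlift_linear tmap_multilinear. Qed.

Lemma tmap_pure v cs : @tmap K V W C h (pure v cs) = pure (h v) cs.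
Proof. exact: tlift_pure tmap_multilinear. Qed.

Lemma tcoeval_natural Phi (t : tens V C) :
  h (tcoeval t Phi) = tcoeval (tmap h t) Phi.
Proof.
move: t; apply: tens_ext.
- by apply: linear_comp => //; exact: tcoeval_linear.
- by apply: linear_comp; [exact: tcoeval_linear | exact: tmap_linear].
move=> v cs; rewrite tmap_pure /tcoeval.
rewrite (tlift_pure _ _ (@tcoeval_multilinear K C V Phi)).
rewrite (tlift_pure _ _ (@tcoeval_multilinear K C W Phi)).
by rewrite (lin_scale _ _ lh).
Qed.

Hypothesis dh : degree_preserving h.

Lemma homog_natural n v : homog n v -> homog n (h v).
Proof. by rewrite /homog -dh => ->. Qed.

Lemma tmap_thomog n l (t : tens V C) : thomog n l t -> thomog n l (tmap h t).
Proof.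
elim=> [|v d cs ds t' hv hcs sc dn _ ih].
  by rewrite (linearP0 tmap_linear); exact: thomog0.
rewrite (lin_add _ _ tmap_linear) tmap_pure.
by apply: thomogD hcs sc dn ih; exact: homog_natural.
Qed.

(** The sign of moving [Phi] past the head depends only on the degree of the head, which [h]
    preserves. *)
Lemma teval_natural Phi (t : tens V C) : h (teval Phi t) = teval Phi (tmap h t).
Proof.
move: t; apply: tens_ext.
- by apply: linear_comp => //; exact: teval_linear.
- by apply: linear_comp; [exact: teval_linear | exact: tmap_linear].
move=> v cs; rewrite tmap_pure /teval !(tlift_pure _ _ (kact_multilinear _ _)).
move: v; apply: homog_ext.
- by apply: linear_comp => //; exact: (kact_multilinear V Phi).1.
- by apply: linear_comp => //; exact: (kact_multilinear W Phi).1.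
move=> n v hv; rewrite /kact (hsum_homog _ hv); last by move=> m; rewrite scaler0.
rewrite (hsum_homog _ (homog_natural hv)); last by move=> m; rewrite scaler0.
by rewrite (lin_scale _ _ lh).
Qed.

End Naturality.

Lemma tmap_id (K : fieldType) (C V : gspace K) (t : tens V C) :
  tmap (fun v : V => v) t = t.
Proof.
have lid : linear (fun v : V => v) by [].
move: t; apply: tens_ext; [exact: tmap_linear | by [] |].
by move=> v cs; rewrite tmap_pure.
Qed.

(** * Fullness, faithfulness and injectivity on objects *)

Section FullEmbedding.
Variables (K : fieldType) (C : ainf_coalgebra K) (A : ainf_algebra K).
Variable f : seq A -> gdual C.
Hypothesis f_pairing : pairing f.

(** The total degree determines |v| from [d], [l] and |cs|. Hence the sign of moving the functionals
    past [v] can be expressed without |v|, and what survives is a twist by [d]. *)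
Lemma teval_tcoeval (V : gspace K) d l (t : tens V C) (Phi : seq (gdual C)) :
  thomog (d + (2 - l.+1%:Z)) l t ->
  teval [seq ksgn (2 - l.+1%:Z) phi | phi <- Phi] t =
  tcoeval t (map (ksgn d) Phi).
Proof.
move: t; apply: thomog_ext; [exact: teval_linear | exact: tcoeval_linear |].
move=> v n cs ds hv hcs _ nE.
rewrite (teval_pure _ hv hcs) (tcoeval_pure _ _ hcs) !(pairw_ksgn _ _ hcs).
rewrite !mulrA -!signr_addb; congr (((-1) ^+ nat_of_bool _ * _) *: _).
have := congr1 pz nE; rewrite !(pzD, pzN, pz_nat) /=.
by case: crossings; case: pz; case: pz; case: pz; case: odd.
Qed.

Lemma blocks_ksgn (U : lmodType K) (G : seq (gdual C) -> U) d i s : wlinear G ->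
  all (leq 1) i -> sumn i = size s ->
  G (map (ksgn d) (blocks f i s)) =
  (-1) ^+ (pz d && odd (excess i)) *: G (blocks f i (map (ksgn d) s)).
Proof.
elim: i s G => [|j i ih] s G lG /=; first by rewrite andbF scale1r.
move=> /andP[j1 i1] jis; have js : (j <= size s)%N by rewrite -jis leq_addr.
rewrite (ih _ (fun t => G (_ :: t))) //; first last.
- by rewrite size_drop -jis addKn.
- exact: wlinear_cons.
have sw : size (take j s) = j by rewrite size_takel.
rewrite (multimap_ksgn _ f_pairing.1) ?size_map ?sw //.
rewrite (wlinear_scale_at [::]) // scalerA -signr_addb -!map_take -map_drop.
rewrite !map_ksgnK [d + _]addrC /excess /= oddD !(pzD, pzN, pz_nat).
congr (_ ^+ nat_of_bool _ *: _); rewrite -[in LHS](prednK j1) /=.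
by case: (pz d); case: (odd _); case: (odd _).
Qed.

(** Both sign rules for restriction of scalars at once: [c] is true for [module_sign] and false for
    [dsign]. *)
Variables (e : seq nat -> nat) (c : bool).
Hypothesis eE : forall i, all (leq 1) i ->
  odd (e i) = odd (dsign i) (+) (c && odd (excess i)).

Lemma size_excess i : all (leq 1) i -> sumn i = (size i + excess i)%N.
Proof.
rewrite /excess; elim: i => //= j i ih /andP[j1 /ih ->].
by rewrite -{1}(prednK j1) !addSn addnCA.
Qed.

(** The leftover sign has exponent a multiple of [excess i]. As [size s] is [size i + excess i], it
    separates into a global sign for the number of arguments and a rescaling of the family that
    depends on l. *)
Lemma restrict_alpha (P : ainf_comodule C) d (x : P) s : homog d x ->
  restrict e f (@dual_op K C P) s x =
  (-1) ^+ ((c (+) pz d) && odd (size s)) *: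
    alpha f (fun l => (-1) ^+ ((c (+) pz d) && odd l) *: comod_w l x)
      (map (ksgn d) s).
Proof.
move=> hx; rewrite /restrict /alpha size_map scaler_sumr.
apply: eq_big_seq => i; rewrite mem_decomps => /andP[i1 /eqP si].
rewrite /dual_op size_blocks.
rewrite (teval_tcoeval (d := d)); last exact: comod_degree.
rewrite (blocks_ksgn _ (tcoeval_wlinear _) i1 si).
rewrite (lin_scale _ _ (@tcoeval_linear _ _ _ _)).
rewrite !scalerA; congr (_ *: _).
rewrite -[(-1) ^+ e i]signr_odd -[(-1) ^+ dsign i]signr_odd -!signr_addb.
congr (_ ^+ nat_of_bool _); rewrite eE // -si size_excess // oddD.
by case: c; case: pz; case: odd; case: odd; case: odd.
Qed.

Hypothesis f_rational : rational f.

Lemma rational_reflects (P Q : ainf_comodule C) (h : P -> Q) :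
  linear h -> degree_preserving h ->
  (forall s x, h (restrict e f (@dual_op K C P) s x) =
     restrict e f (@dual_op K C Q) s (h x)) ->
  forall l x, tmap h (comod_w l x) = comod_w l (h x).
Proof.
move=> lh dh hop l; apply: homog_ext.
- by apply: linear_comp; [exact: tmap_linear | exact: comod_linear].
- by apply: linear_comp => //; exact: comod_linear.
move=> d x hx; have hhx := homog_natural dh hx.
pose g n : K := (-1) ^+ ((c (+) pz d) && odd n).
have g1 n (V : lmodType K) (u : V) : g n *: (g n *: u) = u.
  by rewrite scalerA /g -signr_addb addbb scale1r.
have dE n : d + 1 - n%:Z = d + (2 - n.+1%:Z).
  by rewrite -[n.+1]addn1 PoszD; ring.
(* Multiplication by [g n] is involutive, so the rescaled families may be compared, as rationality
   requires. *)
suff E : forall n, g n *: tmap h (comod_w n x) = g n *: comod_w n (h x).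
  by rewrite -(g1 l _ (tmap _ _)) E g1.
(* The map w_{n+1} has degree 1 - n, so on [x] of degree [d] the family has total degree d + 1. *)
apply: (f_rational (d := d + 1)).
- move=> n; rewrite dE; apply: thomog_scale; apply: tmap_thomog => //.
  exact: comod_degree.
- by move=> n; rewrite dE; apply: thomog_scale; exact: comod_degree.
move=> s.
(* Compatibility is used on the twisted word, to cancel the twist by [d] in [restrict_alpha]. *)
have sE : s = map (ksgn d) (map (ksgn d) s).
  by rewrite map_ksgnK map_ksgn_even // pzD addbb.
have := hop (map (ksgn d) s) x; rewrite (restrict_alpha _ hx) (restrict_alpha _ hhx).
rewrite -sE -/(g _) (lin_scale _ _ lh).
move=> /(congr1 (fun y => g (size (map (ksgn d) s)) *: y)); rewrite !g1 => <-; rewrite /alpha (lin_sum _ _ _ lh); apply: eq_bigr => i _.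
rewrite (lin_scale _ _ lh) (tcoeval_natural lh).
by rewrite /= (lin_scale _ _ (tmap_linear lh)).
Qed.

Lemma morphismE (P Q : ainf_comodule C) (h : P -> Q) :
  comod_morphism h <->
  @module_morphism K A (iotaCA_with e f P) (iotaCA_with e f Q) h.
Proof.
split=> -[lh dh hw]; split=> //; last first.
  exact: rational_reflects.
move=> s x; rewrite /= /restrict (lin_sum _ _ _ lh); apply: eq_bigr => i _.
by rewrite (lin_scale _ _ lh) /dual_op teval_natural // hw.
Qed.

(** Destructing the equality of carriers obtained here leaves two operations on one graded space,
    with no dependent equality between them. *)
Lemma premodule_eq (B : gspace K) (M N : premodule B) : M = N ->
  exists E : premod_car M = premod_car N, forall s x,
    eq_rect _ (fun V : gspace K => V : Type) (premod_op s x) _ E =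
    premod_op s (eq_rect _ (fun V : gspace K => V : Type) x _ E).
Proof. by move=> ->; exists erefl. Qed.

Lemma iota_injective (P Q : ainf_comodule C) :
  iotaCA_with e f P = iotaCA_with e f Q -> P = Q.
Proof.
case: P Q => [V w w1 w2 w3] [V' w' w1' w2' w3'] /premodule_eq[/= E].
destruct E => /= hop.
set P := AinfComodule w1 w2 w3; set Q := AinfComodule w1' w2' w3'.
(* The identity of the common carrier is compatible with the module structures, so rationality
   identifies the coactions; the other fields are proofs. *)
have E : w = w'.
  apply: funext => l; apply: funext => x.
  by rewrite -[RHS](@rational_reflects P Q id _ _ _ l x) // tmap_id.
rewrite /P /Q; destruct E.
by rewrite (Prop_irrelevance w1 w1') (Prop_irrelevance w2 w2')
  (Prop_irrelevance w3 w3').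
Qed.

Lemma full_embeddingP : full_embedding e f.
Proof. by split; [exact: morphismE | exact: iota_injective]. Qed.

End FullEmbedding.

Unset Implicit Arguments.

Theorem proposition8p4 (K : fieldType) (C : ainf_coalgebra K)
    (A : ainf_algebra K) (f : seq A -> gdual C)
    (f_pairing : pairing f) (f_rational : rational f) :
  [/\ forall P : ainf_comodule C, is_ainf_module (iotaCA f P),
      full_embedding module_sign f &
      full_embedding dsign f].
Proof.
split; first by move=> P; exact: iota_module.
  apply: (full_embeddingP f_pairing (c := true)) => // i i1.
  by rewrite module_signE // oddD.
by apply: (full_embeddingP f_pairing (c := false)) => // i i1; rewrite addbF.
Qed.
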